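(* Let $N\geq 2$, $p>1$, let $\Omega\subset\mathbb{R}^N$ be a bounded and smooth domain, and let $u$ be the weak solution of $$-\Delta_p w=\frac{\mu(\Omega)}{|\Omega|}w^{-1}\ \text{in }\Omega,\qquad w>0\ \text{in }\Omega,\qquad w=0\ \text{on }\partial\Omega.$$ Then $$J(u)=\frac{\mu(\Omega)}{p}=\min_{v\in W_0^{1,p}(\Omega)}J(v).$$
   Context: $|\Omega|$ denotes the $N$-dimensional Lebesgue measure of $\Omega$, $\|\cdot\|_p$ the norm of $L^p(\Omega)$, and $\Delta_p v=\operatorname{div}(|\nabla v|^{p-2}\nabla v)$. For $q\in(0,1)$, $$\lambda_q(\Omega):=\inf\left\{\|\nabla v\|_p^p : v\in W_0^{1,p}(\Omega)\ \text{and}\ \int_\Omega |v|^q\,dx=1\right\},\qquad \mu(\Omega):=\lim_{q\to0^+}\lambda_q(\Omega)|\Omega|^{p/q}\in(0,\infty).$$ Integrals $\int_\Omega\log|v|\,dx$ with $v\in L^1(\Omega)$ take values in $[-\infty,\infty)$, with $\log 0=-\infty$. The functional $J:W_0^{1,p}(\Omega)\to(-\infty,\infty]$ is $$J(v):=\frac1p\int_\Omega|\nabla v|^p\,dx-\frac{\mu(\Omega)}{|\Omega|}\int_\Omega\log|v|\,dx\quad\text{if }\int_\Omega\log|v|\,dx\in(-\infty,\infty),$$ and $J(v):=\infty$ if $\int_\Omega\log|v|\,dx=-\infty$. For $\lambda>0$, a weak solution of $-\Delta_p w=\lambda w^{-1}$ in $\Omega$, $w>0$ in $\Omega$, $w=0$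 on $\partial\Omega$, is a function $w\in W_0^{1,p}(\Omega)$ with $\operatorname{ess\,inf}_K w>0$ for each compact $K\subset\Omega$ and $\int_\Omega|\nabla w|^{p-2}\nabla w\cdot\nabla\varphi\,dx=\lambda\int_\Omega w^{-1}\varphi\,dx$ for all $\varphi\in W_0^{1,p}(\Omega)$. For $\lambda=\mu(\Omega)/|\Omega|$ such a solution exists and is unique. *)

(* Defs.v *)
From HB Require Import structures.
From mathcomp Require Import all_boot all_order all_algebra.
From mathcomp Require Import all_classical all_reals all_analysis.
From mathcomp Require Import ess_sup_inf.

Set Implicit Arguments.
Unset Strict Implicit.
Unset Printing Implicit Defensive.
Import Order.TTheory GRing.Theory Num.Theory.
Import numFieldNormedType.Exports.
Local Open Scope classical_set_scope.
Local Open Scope ring_scope.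

(* The product sigma-algebra on R^n, generated by the coordinate maps; it is
   the Borel sigma-algebra. *)
Section rV_measurable.
Context {R : realType}.
Variable n : nat.

Let coord : 'I_n -> 'rV[R]_n -> R := fun i x => x ord0 i.

Let rV_set0 : g_sigma_preimage coord set0.
Proof. exact: sigma_algebra0. Qed.

Let rV_setC A : g_sigma_preimage coord A -> g_sigma_preimage coord (~` A).
Proof. exact: sigma_algebraC. Qed.

Let rV_bigcup (F : _^nat) : (forall i, g_sigma_preimage coord (F i)) ->
  g_sigma_preimage coord (\bigcup_i (F i)).
Proof. exact: sigma_algebra_bigcup. Qed.

HB.instance Definition _ := @isMeasurable.Build default_measure_display
  'rV[R]_n (g_sigma_preimage coord) rV_set0 rV_setC rV_bigcup.

End rV_measurable.

Lemma measurable_rV_coord (R : realType) n (i : 'I_n) :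
  measurable_fun [set: 'rV[R]_n] (fun x : 'rV[R]_n => x ord0 i).
Proof.
move=> _ Y mY; rewrite setTI; apply: sub_sigma_algebra => /=.
rewrite -bigcup_seq/=; exists i => /=; first by rewrite mem_index_enum.
by exists Y => //; rewrite setTI.
Qed.

Lemma measurable_fun_rVP d (T : measurableType d) (R : realType) n
    (f : T -> 'rV[R]_n) :
  (forall i, measurable_fun [set: T] (fun x => f x ord0 i)) ->
  measurable_fun [set: T] f.
Proof.
move=> mf _ Y mY; rewrite setTI.
pose G : set_system 'rV[R]_n := fun B => measurable (f @^-1` B).
suff : measurable `<=` G by exact.
apply: smallest_sub.
- split; rewrite /G.
  + by rewrite preimage_set0.
  + by move=> A mA; rewrite setTD preimage_setC; exact: measurableC.
  + by move=> F mF; rewrite preimage_bigcup; exact: bigcup_measurable.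
- rewrite -bigcup_seq => A [i _] [B mB <-]; rewrite /G setTI.
  by have := mf i measurableT B mB; rewrite setTI.
Qed.

(* The identification R * R^n = R^(n+1), with the scalar as first coordinate,
   and its inverse. *)
Definition rV_cons (R : realType) n (z : R * 'rV[R]_n) : 'rV[R]_n.+1 :=
  \row_i oapp (z.2 ord0) z.1 (unlift ord0 i).

Definition rV_uncons (R : realType) n (x : 'rV[R]_n.+1) : R * 'rV[R]_n :=
  (x ord0 ord0, \row_j x ord0 (lift ord0 j)).

Lemma rV_consK (R : realType) n : cancel (@rV_cons R n) (@rV_uncons R n).
Proof.
move=> [a y]; rewrite /rV_cons /rV_uncons /= mxE unlift_none /=; congr pair.
by apply/rowP => j; rewrite !mxE liftK.
Qed.

Lemma rV_unconsK (R : realType) n : cancel (@rV_uncons R n) (@rV_cons R n).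
Proof.
move=> x; apply/rowP => i; rewrite mxE /=.
by case: unliftP => [j|] -> //=; rewrite mxE.
Qed.

Lemma measurable_rV_cons (R : realType) n :
  measurable_fun [set: measurableTypeR R * 'rV[R]_n] (@rV_cons R n).
Proof.
apply: measurable_fun_rVP => i; rewrite /rV_cons.
under eq_fun do rewrite mxE.
case: (unlift ord0 i) => [j|] /=; last exact: measurable_fst.
exact: measurableT_comp (measurable_rV_coord j) measurable_snd.
Qed.

Lemma measurable_rV_uncons (R : realType) n :
  measurable_fun [set: 'rV[R]_n.+1] (@rV_uncons R n).
Proof.
apply/measurable_fun_pairP; split; first exact: measurable_rV_coord.
apply: measurable_fun_rVP => j /=.
under eq_fun do rewrite mxE.
exact: measurable_rV_coord.
Qed.

Lemma product_sigma_finite d1 d2 (T1 : measurableType d1)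
    (T2 : measurableType d2) (R : realType)
    (m1 : {sigma_finite_measure set T1 -> \bar R})
    (m2 : {sigma_finite_measure set T2 -> \bar R}) :
  sigma_finite setT (m1 \x m2)%E.
Proof.
have /sigma_finiteP[F [TF ndF Foo]] := sigma_finiteT m1.
have /sigma_finiteP[G [TG ndG Goo]] := sigma_finiteT m2.
exists (fun n => F n `*` G n).
  rewrite -setXTT TF TG predeqE => -[x y]; split.
    move=> [/= [n _ Fnx] [k _ Gky]]; exists (maxn n k) => //; split.
    - by move: x Fnx; exact/subsetPset/ndF/leq_maxl.
    - by move: y Gky; exact/subsetPset/ndG/leq_maxr.
  by move=> [n _ []/= ? ?]; split; exists n.
move=> k; have [? ?] := Foo k; have [? ?] := Goo k.
split; first exact: measurableX.
by rewrite product_measure1E// lte_mul_pinfty// ge0_fin_numE.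
Qed.

Section lebesgue_rV_step.
Context {R : realType} {n : nat}.
Variable m : {sigma_finite_measure set 'rV[R]_n -> \bar R}.

Definition lebesgue_rV_step : set 'rV[R]_n.+1 -> \bar R :=
  pushforward (@lebesgue_measure R \x m)%E (@rV_cons R n).

Let mcons : measurable_fun [set: measurableTypeR R * 'rV[R]_n] (@rV_cons R n).
Proof. exact: measurable_rV_cons. Qed.

Let step0 : lebesgue_rV_step set0 = 0%E.
Proof. by rewrite /lebesgue_rV_step /pushforward preimage_set0 measure0. Qed.

Let step_ge0 A : (0 <= lebesgue_rV_step A)%E.
Proof. exact: measure_ge0. Qed.

Let step_sigma_additive : semi_sigma_additive lebesgue_rV_step.
Proof.
move=> F mF tF mUF; rewrite /lebesgue_rV_step /pushforward preimage_bigcup.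
apply: measure_semi_sigma_additive.
- by move=> k; rewrite -[X in measurable X]setTI; exact: mcons.
- apply/trivIsetP => /= i j _ _ ij; rewrite -preimage_setI.
  by move/trivIsetP : tF => /(_ _ _ _ _ ij) ->//; rewrite preimage_set0.
- by rewrite -preimage_bigcup -[X in measurable X]setTI; exact: mcons.
Qed.
HB.instance Definition _ := isMeasure.Build _ _ _ lebesgue_rV_step
  step0 step_ge0 step_sigma_additive.

Let step_sigma_finite : sigma_finite setT lebesgue_rV_step.
Proof.
have [F FT Ffin] := product_sigma_finite (@lebesgue_measure R) m.
exists (fun k => @rV_uncons R n @^-1` F k).
  by rewrite -preimage_bigcup -FT preimage_setT.
move=> k; have [mF Foo] := Ffin k; split.
  by rewrite -[X in measurable X]setTI; exact: measurable_rV_uncons.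
rewrite /lebesgue_rV_step /pushforward -comp_preimage.
by rewrite (_ : _ \o _ = id) //; apply/funext => z /=; rewrite rV_consK.
Qed.

HB.instance Definition _ := @Measure_isSigmaFinite.Build _ _ _
  lebesgue_rV_step step_sigma_finite.

End lebesgue_rV_step.

(* Lebesgue measure on the Borel sets of R^n, as an iterated product. *)
Fixpoint lebesgue_rV (R : realType) n :
    {sigma_finite_measure set 'rV[R]_n -> \bar R} :=
  match n with
  | 0 => [the {sigma_finite_measure set 'rV[R]_0 -> \bar R} of
            dirac (0 : 'rV[R]_0)]
  | n'.+1 => [the {sigma_finite_measure set 'rV[R]_n'.+1 -> \bar R} of
            lebesgue_rV_step (lebesgue_rV R n')]
  end.

Lemma lebesgue_rV_box (R : realType) n (a b : 'I_n -> R) :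
  lebesgue_rV R n [set x | forall i, x ord0 i \in `]a i, b i]] =
  (\prod_i lebesgue_measure (`]a i, b i] : set R))%E.
Proof.
elim: n a b => [|n IH] a b /=.
  rewrite big_ord0 diracE mem_set//=. by case.
pose a' := a \o lift ord0; pose b' := b \o lift ord0.
pose B : set 'rV[R]_n := [set x | forall i, x ord0 i \in `]a' i, b' i]].
transitivity (lebesgue_rV R n.+1
    (@rV_uncons R n @^-1` (`]a ord0, b ord0] `*` B))).
  congr (lebesgue_rV R n.+1 _); apply/seteqP; split => x /=.
    by move=> h; split => [|i]; [exact: h|rewrite mxE; exact: h].
  move=> [h0 h] i; case: (unliftP ord0 i) => [j|] -> //.
  by move: (h j); rewrite mxE.
rewrite /= /lebesgue_rV_step /pushforward -comp_preimage.
rewrite (_ : _ \o _ = id); last by apply/funext => z /=; rewrite rV_consK.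
rewrite preimage_id product_measure1E.
- by rewrite IH big_ord_recl.
- exact: measurable_itv.
have -> : B = \bigcap_(i in [set: 'I_n])
    ((fun x : 'rV[R]_n => x ord0 i) @^-1` `]a' i, b' i]).
  by apply/seteqP; split => x /= h i //=; exact: h.
apply: fin_bigcap_measurable => // i _.
by rewrite -[X in measurable X]setTI; exact: measurable_rV_coord.
Qed.

(* The norm of the library on 'rV is the sup norm, hence this one. *)
Definition enorm (R : realType) n (x : 'rV[R]_n) : R :=
  Num.sqrt (\sum_i x ord0 i ^+ 2).

Definition dotrV (R : realType) n (x y : 'rV[R]_n) : R :=
  \sum_i x ord0 i * y ord0 i.

Definition pderiv (R : realType) n (f : 'rV[R]_n -> R) (i : 'I_n) :
    'rV[R]_n -> R :=
  fun x => 'D_(delta_mx ord0 i) f x.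

Definition cgrad (R : realType) n (f : 'rV[R]_n -> R) :
    'rV[R]_n -> 'rV[R]_n :=
  fun x => \row_i pderiv f i x.

(* C^k in terms of iterated partial derivatives. *)
Fixpoint Ck (R : realType) n (k : nat) (f : 'rV[R]_n -> R) : Prop :=
  continuous f /\
  match k with
  | 0 => True
  | k'.+1 => forall i,
      (forall x, derivable f x (delta_mx ord0 i)) /\ Ck k' (pderiv f i)
  end.

Definition smooth (R : realType) n (f : 'rV[R]_n -> R) : Prop :=
  forall k, Ck k f.

(* C_c^oo(Omega), each function being extended by 0 to the whole space. *)
Definition test_function (R : realType) n (Omega : set 'rV[R]_n)
    (phi : 'rV[R]_n -> R) : Prop :=
  smooth phi /\
  exists K : set 'rV[R]_n,
    [/\ compact K, K `<=` Omega & forall x, ~ K x -> phi x = 0].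

(* Near each boundary point, Omega is the set lying on one side of the graph
   of a smooth function, after choosing which coordinate to express in terms
   of the other ones and how to orient it. *)
Definition smooth_boundary (R : realType) n (Omega : set 'rV[R]_n) : Prop :=
  forall x, (closure Omega `\` Omega^°) x ->
  exists (i : 'I_n) (s : bool) (gamma : 'rV[R]_n.-1 -> R),
    smooth gamma /\
    \forall y \near x, Omega y <-> gamma (col' i y) < (-1) ^+ s * y ord0 i.

Definition smooth_bounded_domain (R : realType) n (Omega : set 'rV[R]_n) :
    Prop :=
  [/\ Omega !=set0, open Omega, connected Omega, bounded_set Omega &
      smooth_boundary Omega].

Section sobolev.
Context {R : realType} {N : nat}.
Variables (p : R) (Omega : set 'rV[R]_N).
Implicit Types (v w phi : 'rV[R]_N -> R) (g : 'rV[R]_N -> 'rV[R]_N).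

Local Notation leb := (lebesgue_rV R N).

Definition in_Lp v : Prop :=
  measurable_fun Omega v /\
  (\int[leb]_(x in Omega) (`|v x| `^ p)%:E < +oo)%E.

Definition weak_gradient v g : Prop :=
  (forall i, in_Lp (fun x => g x ord0 i)) /\
  forall phi i, test_function Omega phi ->
    (\int[leb]_(x in Omega) (v x * pderiv phi i x)%:E =
     - \int[leb]_(x in Omega) (g x ord0 i * phi x)%:E)%E.

Definition W1p v : Prop := in_Lp v /\ exists g, weak_gradient v g.

(* The weak gradient of v, determined up to a null set; 0 when v has none. *)
Definition grad v : 'rV[R]_N -> 'rV[R]_N :=
  xget (fun=> 0) [set g | weak_gradient v g].

(* The closure of C_c^oo(Omega) in W^{1,p}(Omega). *)
Definition W01p v : Prop :=
  W1p v /\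
  exists phi_ : nat -> 'rV[R]_N -> R,
    [/\ forall k, test_function Omega (phi_ k),
        (\int[leb]_(x in Omega) (`|phi_ k x - v x| `^ p)%:E)%E
          @[k --> \oo] --> 0%E &
        (\int[leb]_(x in Omega) (enorm (cgrad (phi_ k) x - grad v x) `^ p)%:E)%E
          @[k --> \oo] --> 0%E].

Definition grad_energy v : \bar R :=
  (\int[leb]_(x in Omega) (enorm (grad v x) `^ p)%:E)%E.

Definition volume : R := fine (leb Omega).

Definition lambda_q (q : R) : \bar R :=
  ereal_inf [set grad_energy v | v in
    [set v | W01p v /\ (\int[leb]_(x in Omega) (`|v x| `^ q)%:E = 1)%E]].

(* The limit is taken in the extended reals; it is positive and finite for a
   smooth bounded domain. *)
Definition mu_Omega : R :=
  fine (lim ((lambda_q q * (volume `^ (p / q))%:E)%E @[q --> 0^'+])).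

(* lne is -oo at 0. *)
Definition log_integral v : \bar R :=
  (\int[leb]_(x in Omega) lne (`|v x|%:E))%E.

Definition J v : \bar R :=
  (if log_integral v \is a fin_num then
    (p^-1)%:E * grad_energy v - (mu_Omega / volume)%:E * log_integral v
  else +oo)%E.

Definition ess_inf_on (K : set 'rV[R]_N) w : \bar R :=
  ess_inf leb (patch (cst +oo%E) K (EFin \o w)).

(* Weak solutions of -Delta_p w = lambda / w, w > 0 in Omega, w = 0 on its
   boundary.  The left-hand integral is always finite (Hoelder), so that the
   equation forces phi / w to be integrable when lambda > 0.  Where grad w
   vanishes the left-hand integrand is 0 for every p, as it should be, since
   0 `^ a is finite also for a < 0. *)
Definition weak_solution (lambda : R) w : Prop :=
  [/\ W01p w,
      forall K : set 'rV[R]_N, compact K -> K `<=` Omega ->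
        (0 < ess_inf_on K w)%E &
      forall phi, W01p phi ->
        (\int[leb]_(x in Omega)
            (enorm (grad w x) `^ (p - 2) * dotrV (grad w x) (grad phi x))%:E =
         lambda%:E * \int[leb]_(x in Omega) ((w x)^-1 * phi x)%:E)%E].

End sobolev.

Definition is_min (R : realType) (A : set (\bar R)) (m : \bar R) : Prop :=
  A m /\ lbound A m.

(* Main.v *)
Require Import Defs.
From HB Require Import structures.
From mathcomp Require Import all_boot all_order all_algebra.
From mathcomp Require Import all_classical all_reals all_analysis.
From mathcomp Require Import ring lra.
From mathcomp Require Import measurable_realfun ess_sup_inf.
Set Implicit Arguments.
Unset Strict Implicit.
Unset Printing Implicit Defensive.
Import Order.TTheory GRing.Theory Num.Theory.
Import numFieldNormedType.Exports.
Local Open Scope classical_set_scope.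
Local Open Scope ring_scope.


(** Write $\lambda = \mu/|\Omega|$, and let means be taken over $\Omega$.

    Testing the equation with $u$ itself gives $\|\nabla u\|_p^p = \mu$
    ([weak_solution_energy]). The $p$-energy is convex, and the weak equation
    computes its differential at $u$; this yields the basic inequality
    [weak_solution_ineq]: for every $v \in W_0^{1,p}(\Omega)$,
    $$\lambda \int_\Omega \frac{|v|}{u} \le \frac{p-1}{p}\,\mu
      + \frac1p \|\nabla v\|_p^p.$$
    Because $\log|v| - \log u \le |v|/u - 1$, it implies $J(v) \ge \mu/p$ for all
    $v$ ([J_ge]) and $J(u) = \mu/p$ ([J_ground]) as soon as
    $\int_\Omega \log u = 0$. That normalization is the point where the
    definition of $\mu$ as a limit enters ([ground_log_integral]).

    Replacing $v$ by its best multiple, the basic inequality becomes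
    $\|\nabla v\|_p^p \ge \mu\, s^p$, where $s$ is the mean of $|v|/u$. For
    $r = q/(1-q)$, Young's inequality interpolates $|v|^q$ between $|v|/u$ and
    $u^r$, and so bounds $s$ from below when $\int_\Omega |v|^q = 1$
    ([lambda_q_ge]). Conversely a multiple of $u$ is admissible in the definition
    of $\lambda_q$ ([lambda_q_le]). With $L$ the mean of $\log u$, these bounds
    enclose $\lambda_q |\Omega|^{p/q}$ between $\mu e^{-p A(r)}$ and
    $\mu e^{-pL}$, where $A(r)$, the mean of $(u^r-1)/r$, decreases to $L$ as $r$
    decreases to 0. Hence $\mu = \mu e^{-pL}$, and $L = 0$ because $\mu > 0$
    ([mu_gt0]): if $\mu$ were 0, then $\nabla u = 0$, and $u$ would have zero mean
    although it is positive.

    Two facts about Sobolev functions have to be built from the definitions.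
    Weak gradients are unique almost everywhere ([weak_gradient_unique]), by the
    fundamental lemma of the calculus of variations, so that energies scale as
    they should; and test functions belong to $W_0^{1,p}(\Omega)$ with their
    classical gradient ([W01p_test_function]), by integration by parts. The
    basic inequality involves $|v|$, which is not a limit of test functions by
    definition; it is proved for the smooth functions $\sqrt{\phi^2+e^2}-e$, where
    $\phi$ is a test function close to $v$, and then passes to the limit. *)

(** * Boxes, Borel sets and Lebesgue measure in Euclidean space *)

Section euclidean_measurability.
Context {R : realType} {n : nat}.
Implicit Types (a b : 'I_n -> R) (U : set 'rV[R]_n).

Definition obox a b : set 'rV[R]_n := [set x | forall i, a i < x ord0 i < b i].
Definition cbox a b : set 'rV[R]_n := [set x | forall i, a i <= x ord0 i <= b i].

Lemma measurable_rV_pi (A : 'I_n -> set R) :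
  (forall i, measurable (A i)) ->
  measurable [set x : 'rV[R]_n | forall i, A i (x ord0 i)].
Proof.
move=> mA.
have -> : [set x : 'rV[R]_n | forall i, A i (x ord0 i)] =
    \bigcap_(i in [set: 'I_n]) ((fun x : 'rV[R]_n => x ord0 i) @^-1` A i).
  by apply/seteqP; split => x /= h i //=; exact: h.
apply: fin_bigcap_measurable => // i _.
by rewrite -[X in measurable X]setTI; exact: measurable_rV_coord.
Qed.

Lemma measurable_obox a b : measurable (obox a b).
Proof.
apply: (@measurable_rV_pi (fun i => [set y | a i < y < b i])) => i.
have -> : [set y | a i < y < b i] = `]a i, b i[%classic.
  by apply/seteqP; split => y /=; rewrite in_itv.
exact: measurable_itv.
Qed.

Lemma measurable_cbox a b : measurable (cbox a b).
Proof.
apply: (@measurable_rV_pi (fun i => [set y | a i <= y <= b i])) => i.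
have -> : [set y | a i <= y <= b i] = `[a i, b i]%classic.
  by apply/seteqP; split => y /=; rewrite in_itv.
exact: measurable_itv.
Qed.

Lemma compact_cbox a b : compact (cbox a b).
Proof.
apply: (@rV_compact R n (fun i => [set y | a i <= y <= b i])) => i.
have -> : [set y | a i <= y <= b i] = `[a i, b i]%classic.
  by apply/seteqP; split => y /=; rewrite in_itv.
exact: segment_compact.
Qed.

(** Corners of the $k$-th box in an enumeration of the boxes with rational
    corners; the box is degenerate when $k$ encodes none. *)
Definition rat_lo (k : nat) : 'I_n -> R := fun i =>
  ratr ((odflt (0, 0) (unpickle k : option ('rV[rat]_n * 'rV[rat]_n))).1 ord0 i).
Definition rat_hi (k : nat) : 'I_n -> R := fun i =>
  ratr ((odflt (0, 0) (unpickle k : option ('rV[rat]_n * 'rV[rat]_n))).2 ord0 i).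

(** Balls of the sup norm are boxes, and each point of such a ball lies in a
    smaller box with rational corners. Countability of these boxes is what
    makes open sets Borel and lets null sets be treated locally. *)
Lemma open_bigcup_obox U : open U ->
  U = \bigcup_(k in [set k | cbox (rat_lo k) (rat_hi k) `<=` U])
        obox (rat_lo k) (rat_hi k).
Proof.
move=> oU; apply/seteqP; split => x; last first.
  by move=> [k /= kU kx]; apply: kU => i; have /andP[/ltW -> /ltW ->] := kx i.
move=> Ux; have /nbhs_ballP[e /= e0 eU] : nbhs x U by exact: open_nbhs_nbhs.
have /choice[l lP] : forall i, exists q : rat, x ord0 i - e < ratr q < x ord0 i.
  move=> i; have /rat_in_itvoo[q] : x ord0 i - e < x ord0 i by rewrite ltrBlDr ltrDl.
  by rewrite in_itv /= => qx; exists q.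
have /choice[h hP] : forall i, exists q : rat, x ord0 i < ratr q < x ord0 i + e.
  move=> i; have /rat_in_itvoo[q] : x ord0 i < x ord0 i + e by rewrite ltrDl.
  by rewrite in_itv /= => qx; exists q.
pose c := (\row_i l i, \row_i h i) : 'rV[rat]_n * 'rV[rat]_n.
have loE : rat_lo (pickle c) = fun i => ratr (l i).
  by apply/funext => i; rewrite /rat_lo pickleK /= mxE.
have hiE : rat_hi (pickle c) = fun i => ratr (h i).
  by apply/funext => i; rewrite /rat_hi pickleK /= mxE.
exists (pickle c) => /=; rewrite loE hiE.
- move=> y yb; apply: eU; split=> // i j; rewrite (ord1 i) /ball /=.
  have /andP[y1 y2] := yb j; have /andP[l1 l2] := lP j; have /andP[h1 h2] := hP j.
  by rewrite ltr_distlC; apply/andP; split; lra.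
- by move=> i; have /andP[_ ->] := lP i; have /andP[-> _] := hP i.
Qed.

Lemma open_rV_measurable U : open U -> measurable U.
Proof.
move=> /open_bigcup_obox ->; apply: bigcup_measurable => k _.
exact: measurable_obox.
Qed.

Lemma continuous_rV_measurable (f : 'rV[R]_n -> R) :
  continuous f -> measurable_fun [set: 'rV[R]_n] f.
Proof.
move=> /continuousP cf; apply: (measurability _ (measurable_realfun.RGenOpens.measurableE R)).
move=> _ [_ [a [b ->] <-]]; rewrite setTI.
by apply: open_rV_measurable; apply: cf; exact: interval_open.
Qed.

(** Countably many of the boxes involved cover the open set, by
    [open_bigcup_obox], and countable unions of null sets are null. *)
Lemma ae_open_obox (mu : {measure set 'rV[R]_n -> \bar R}) U
    (P : 'rV[R]_n -> Prop) : open U ->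
  (forall a b, cbox a b `<=` U -> {ae mu, forall x, obox a b x -> P x}) ->
  {ae mu, forall x, U x -> P x}.
Proof.
move=> /open_bigcup_obox UE aeP.
have : \forall x \ae mu, forall k, cbox (rat_lo k) (rat_hi k) `<=` U ->
    obox (rat_lo k) (rat_hi k) x -> P x.
  apply: ae_foralln => k.
  have [kU|kU] := pselect (cbox (rat_lo k) (rat_hi k) `<=` U).
    by apply: filterS (aeP _ _ kU) => x Px _.
  by apply: aeW => x /kU.
by apply: filterS => x Px; rewrite UE => -[k kU kx]; exact: (Px k).
Qed.

Lemma lebesgue_cbox_lty a b : (lebesgue_rV R n (cbox a b) < +oo)%E.
Proof.
pose a' i := a i - 1.
have sub : cbox a b `<=` [set x : 'rV[R]_n | forall i, x ord0 i \in `]a' i, b i]].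
  move=> x xab i; rewrite in_itv /=; have /andP[h ->] := xab i.
  by rewrite andbT /a'; lra.
apply: le_lt_trans (le_measure _ _ _ sub) _.
- by rewrite inE; exact: measurable_cbox.
- rewrite inE; apply: (@measurable_rV_pi (fun i => [set` `]a' i, b i]])) => i.
  exact: measurable_itv.
rewrite [ltLHS](lebesgue_rV_box a' b) -ge0_fin_numE; last first.
  by apply: prode_ge0 => i _; exact: measure_ge0.
elim/big_ind : _ => // [x y hx hy|i _]; first exact: fin_numM.
by rewrite lebesgue_measure_itv; case: ifP.
Qed.

Lemma lebesgue_obox_gt0 a b : (forall i, a i < b i) ->
  (0 < lebesgue_rV R n (obox a b))%E.
Proof.
move=> ab; pose b' i := (a i + b i) / 2.
have sub : [set x : 'rV[R]_n | forall i, x ord0 i \in `]a i, b' i]] `<=` obox a b.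
  move=> x xab i; have := xab i; have := ab i.
  by rewrite in_itv /= /b' => h /andP[-> h']; lra.
have mb : measurable [set x : 'rV[R]_n | forall i, x ord0 i \in `]a i, b' i]].
  apply: (@measurable_rV_pi (fun i => [set` `]a i, b' i]])) => i.
  exact: measurable_itv.
have := le_measure (lebesgue_rV R n) (mem_set mb)
  (mem_set (measurable_obox a b)) sub.
apply: lt_le_trans.
rewrite [ltRHS](lebesgue_rV_box a b'); elim/big_ind : _ => // [x y|i _].
  exact: mule_gt0.
rewrite lebesgue_measure_itv /= lte_fin /b'; have := ab i => abi.
by rewrite ifT; [rewrite -EFinB lte_fin|]; lra.
Qed.

Lemma bounded_cbox U : bounded_set U -> exists M : R,
  0 < M /\ U `<=` cbox (fun=> - M) (fun=> M).
Proof.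
move=> [M [Mreal MU]]; exists (Num.max M 0 + 1); split.
  by rewrite ltr_wpDl// le_max lexx orbT.
move=> x /(MU (Num.max M 0 + 1)) xM i; rewrite -ler_norml.
apply: le_trans (xM _); last by rewrite ltr_pwDr// le_max lexx.
rewrite [leRHS]/Num.norm /= mx_normrE; apply/bigmax_geP; right => /=.
by exists (ord0, i).
Qed.

End euclidean_measurability.

(** * Calculus of iterated partial derivatives *)

Section directional_derivatives.
Context {R : realType} {V : normedModType R}.

Lemma is_derive_line (f : V -> R) (x v : V) (b : R) :
  is_derive x v f b <-> is_derive (0 : R) 1 (fun h : R => f (h *: v + x)) b.
Proof.
pose g (h : R) := f (h *: v + x).
have E : (fun h : R => h^-1 *: (f (h *: v + x) - f x)) =
    (fun h : R => h^-1 *: (g (h *: (1 : R^o) + 0) - g 0)).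
  by apply/funext => h; rewrite /g addr0 scale0r add0r /GRing.scale /= mulr1.
rewrite -/g; split=> -[dv de]; split.
- by move: dv; rewrite /derivable E.
- by move: de; rewrite /derive E.
- by move: dv; rewrite /derivable E.
- by move: de; rewrite /derive E.
Qed.

Lemma is_derive_comp1 (g : R -> R) (f : V -> R) (x v : V) (a b : R) :
  is_derive (f x) 1 g a -> is_derive x v f b -> is_derive x v (g \o f) (a * b).
Proof.
move=> dg /is_derive_line df; apply/is_derive_line.
apply: (is_derive1_comp (f := g) (g := fun h : R => f (h *: v + x))) => //.
by rewrite scale0r add0r.
Qed.

End directional_derivatives.

Section Ck_calculus.
Context {R : realType} {n : nat}.
Implicit Types (f g : 'rV[R]_n -> R) (k : nat).

Lemma Ck_continuous k f : Ck k f -> continuous f.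
Proof. by case: k => [|k] []. Qed.

Lemma Ck_pderiv k f i : Ck k.+1 f -> Ck k (pderiv f i).
Proof. by move=> [_ /(_ i)[]]. Qed.

Lemma Ck_is_derive k f i x : Ck k.+1 f ->
  is_derive x (delta_mx ord0 i) f (pderiv f i x).
Proof. by move=> [_ /(_ i)[/(_ x) df _]]; exact: DeriveDef. Qed.

Lemma CkW k f : Ck k.+1 f -> Ck k f.
Proof.
elim: k f => [|k IH] f [cf df]; split => // i.
by have [d1 d2] := df i; split => //; exact: IH.
Qed.

(** The form in which differentiability is proved below: candidate partial
    derivatives $d_i$ are exhibited, and their regularity is checked. *)
Lemma CkS k f (d : 'I_n -> 'rV[R]_n -> R) : continuous f ->
  (forall i x, is_derive x (delta_mx ord0 i) f (d i x)) ->
  (forall i, Ck k (d i)) -> Ck k.+1 f.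
Proof.
move=> cf df cd; split => // i; split; first by move=> x; have [] := df i x.
rewrite (_ : pderiv f i = d i) //.
by apply/funext => x; rewrite /pderiv; exact: derive_val.
Qed.

Lemma Ck_cst k (c : R) : Ck k (fun _ : 'rV[R]_n => c).
Proof.
elim: k c => [|k IH] c; first by split => //; exact: cst_continuous.
apply: (@CkS _ _ (fun _ _ => 0)) => [|i]; first exact: cst_continuous.
exact: IH.
Qed.

Lemma CkD k f g : Ck k f -> Ck k g -> Ck k (fun x => f x + g x).
Proof.
elim: k f g => [|k IH] f g cf cg.
  by split => // x; apply: (@continuousD _ _ _ f g); [apply: (Ck_continuous cf)|apply: (Ck_continuous cg)].
apply: (@CkS _ _ (fun i x => pderiv f i x + pderiv g i x)) => [x|i x|i].
- by apply: (@continuousD _ _ _ f g); [apply: (Ck_continuous cf)|apply: (Ck_continuous cg)].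
- exact: (is_deriveD (Ck_is_derive i x cf) (Ck_is_derive i x cg)).
- by apply: IH; exact: Ck_pderiv.
Qed.

Lemma CkM k f g : Ck k f -> Ck k g -> Ck k (fun x => f x * g x).
Proof.
elim: k f g => [|k IH] f g cf cg.
  by split => // x; apply: (@continuousM _ _ f g); [apply: (Ck_continuous cf)|apply: (Ck_continuous cg)].
apply: (@CkS _ _ (fun i x => f x * pderiv g i x + g x * pderiv f i x)) => [x|i x|i].
- by apply: (@continuousM _ _ f g); [apply: (Ck_continuous cf)|apply: (Ck_continuous cg)].
- exact: (is_deriveM (Ck_is_derive i x cf) (Ck_is_derive i x cg)).
- by apply: CkD; apply: IH; first [exact: CkW|exact: Ck_pderiv].
Qed.

Lemma CkZ k (c : R) f : Ck k f -> Ck k (fun x => c * f x).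
Proof. by move=> cf; apply: CkM => //; exact: Ck_cst. Qed.

Lemma Ck_prod k (I : Type) (r : seq I) (F : I -> 'rV[R]_n -> R) :
  (forall i, Ck k (F i)) -> Ck k (fun x => \prod_(i <- r) F i x).
Proof.
move=> cF; elim: r => [|i r IH].
  by under eq_fun do rewrite big_nil; exact: Ck_cst.
by under eq_fun do rewrite big_cons; exact: CkM.
Qed.

Lemma is_derive_coord (i j : 'I_n) (x : 'rV[R]_n) :
  is_derive x (delta_mx ord0 j) (fun y : 'rV[R]_n => y ord0 i) (i == j)%:R.
Proof.
apply/is_derive_line.
rewrite (_ : (fun h : R => _) = (fun h : R => (i == j)%:R * h + x ord0 i)).
  rewrite -[X in is_derive _ _ _ X]addr0; apply: is_deriveD.
  rewrite -[X in is_derive _ _ _ X]mulr1.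
  exact: (@is_deriveZ _ _ _ id).
by apply/funext => h; rewrite !mxE eqxx /= mulrC.
Qed.

Lemma Ck_coord k (i : 'I_n) : Ck k (fun x : 'rV[R]_n => x ord0 i).
Proof.
case: k => [|k]; first by split => // x; exact: coord_continuous.
apply: (@CkS _ _ (fun j _ => (i == j)%:R)) => [x|j x|j].
- exact: coord_continuous.
- exact: is_derive_coord.
- exact: Ck_cst.
Qed.

Lemma Ck_inv k f : (forall x, f x != 0) -> Ck k f -> Ck k (fun x => (f x)^-1).
Proof.
move=> f0; elim: k f f0 => [|k IH] f f0 cf.
  by split => // x; apply: continuousV => //; exact: (Ck_continuous cf).
apply: (@CkS _ _ (fun i x => (-1 * ((f x)^-1 * (f x)^-1)) * pderiv f i x)) => [x|i x|i].
- by apply: continuousV => //; exact: (Ck_continuous cf).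
- apply: DeriveDef.
    by apply: derivableV => //; have [] := Ck_is_derive i x cf.
  rewrite deriveV //; last by have [] := Ck_is_derive i x cf.
  by rewrite /GRing.scale /= /pderiv -invfM -expr2 mulN1r.
- apply: CkM; last exact: Ck_pderiv.
  by apply: CkZ; apply: CkM; apply: IH => //; exact: CkW.
Qed.

Lemma Ck_sqrt k f : (forall x, 0 < f x) -> Ck k f -> Ck k (fun x => Num.sqrt (f x)).
Proof.
move=> f0; elim: k => [|k IH] cf.
  split => // x; apply: (@continuous_comp _ _ _ f Num.sqrt).
    exact: (Ck_continuous cf).
  exact: sqrt_continuous.
apply: (@CkS _ _ (fun i x => (2 * Num.sqrt (f x))^-1 * pderiv f i x)) => [x|i x|i].
- apply: (@continuous_comp _ _ _ f Num.sqrt); first exact: (Ck_continuous cf).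
  exact: sqrt_continuous.
- exact: (is_derive_comp1 (is_derive1_sqrt (f0 x)) (Ck_is_derive i x cf)).
- apply: CkM; last exact: Ck_pderiv.
  apply: Ck_inv => [x|]; last by apply: CkZ; apply: IH; exact: CkW.
  by rewrite mulf_neq0 // sqrtr_eq0 -ltNge.
Qed.

End Ck_calculus.

Section flat_functions.
Context {R : realType}.

(** The functions $t^{-m} e^{-1/t}$, extended by 0 to $t \le 0$. Only $m = 0$ is
    used to build test functions; the other ones make the family closed under
    differentiation, so that its members are smooth. *)
Definition flat (m : nat) (t : R) : R :=
  if 0 < t then t ^- m * expR (- t^-1) else 0.

Lemma flat_ge0 m t : 0 <= flat m t.
Proof.
rewrite /flat; case: ifP => // t0.
by rewrite mulr_ge0 ?expR_ge0 // invr_ge0 exprn_ge0 // ltW.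
Qed.

(** Since $e^{1/t}$ dominates every power of $1/t$. A quadratic bound gives both
    continuity and a zero derivative at the origin. *)
Lemma flat_le m t : flat m t <= (m.+2)`!%:R * t ^+ 2.
Proof.
rewrite /flat; case: ifPn => [t0|_]; last first.
  by rewrite mulr_ge0 ?sqr_ge0.
have h : t^-1 ^+ m.+2 / (m.+2)`!%:R <= expR t^-1.
  apply: le_trans (expR_ge1Dxn m.+1 _); first by rewrite lerDr.
  by rewrite invr_ge0 ltW.
have tm : 0 < t ^+ m.+2 by rewrite exprn_gt0.
have fm : (0 : R) < (m.+2)`!%:R by rewrite ltr0n fact_gt0.
rewrite expRN.
have h' : (expR t^-1)^-1 <= (m.+2)`!%:R * t ^+ m.+2.
  rewrite -[leRHS]invrK lef_pV2 ?posrE ?expR_gt0 // ?invr_gt0; last first.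
    exact: mulr_gt0.
  by rewrite invfM mulrC -exprVn.
apply: le_trans (ler_wpM2l _ h') _; first by rewrite invr_ge0 exprn_ge0 // ltW.
rewrite mulrCA ler_pM2l // -[m.+2]addn2 exprD mulrA mulVf ?mul1r //.
by rewrite expf_neq0 // gt_eqF.
Qed.

Lemma is_derive_flat m (t : R) : is_derive t 1 (flat m) (flat m.+2 t - m%:R * flat m.+1 t).
Proof.
have [t0|t0|<-] := ltgtP 0 t.
- have E : is_derive t 1 (fun t : R => (t^-1) ^+ m * expR (- t^-1))
      (flat m.+2 t - m%:R * flat m.+1 t).
    have d1 : is_derive t 1 (fun t : R => t^-1) (- t ^- 2).
      rewrite -[X in is_derive _ _ _ X]mulr1.
      by apply: (is_deriveV (f := id)); rewrite gt_eqF.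
    have d2 : is_derive t 1 (fun t : R => expR (- t^-1)) (expR (- t^-1) * t ^- 2).
      apply: (is_derive1_comp (f := expR) (g := fun t : R => - t^-1)).
      by rewrite -[t ^- 2]opprK; apply: is_deriveN.
    have d3 : is_derive t 1 (fun t : R => (t^-1) ^+ m)
        (m%:R * t^-1 ^+ m.-1 * - t ^- 2).
      have := is_deriveX m d1.
      by rewrite exprfctE.
    apply: is_derive_eq (is_deriveM d3 d2) _.
    rewrite /GRing.scale /= /flat t0 -!exprVn; case: m {d3} => [|m] /=; [rewrite ?expr0 mulr0n; ring | rewrite -natr1 !exprS; ring].
  apply: DeriveDef.
    apply: near_eq_derivable (ex_derive); near=> s.
    by rewrite /flat ifT ?exprVn //; near: s; exact: lt_nbhsr.
  rewrite -(derive_val (is_derive := E)); apply: near_eq_derive; near=> s.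
  by rewrite /flat ifT ?exprVn //; near: s; exact: lt_nbhsr.
- rewrite /flat ltNge (ltW t0) /= mulr0 subr0.
  apply: DeriveDef.
    apply: (@near_eq_derivable _ _ _ (cst 0)); last exact: derivable_cst.
    near=> s; rewrite /flat ifF // ltNge ltW //; near: s; exact: lt_nbhsl.
  transitivity ('D_1 (cst 0 : R -> R) t); last by rewrite derive_cst.
  apply: near_eq_derive.
  near=> s; rewrite /flat ifF // ltNge ltW //; near: s; exact: lt_nbhsl.
- have f0 j : flat j 0 = 0 by rewrite /flat ltxx.
  rewrite !f0 mulr0 subr0.
  have : (fun h : R => h^-1 *: (flat m (h *: 1 + 0) - flat m 0)) h @[h --> 0^'] --> 0.
    apply: (@squeeze_cvgr _ _ _ _ (fun h => - ((m.+2)`!%:R * `|h|))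
                                  (fun h => (m.+2)`!%:R * `|h|)).
    - near=> h; have h0 : h != 0 by near: h; exact: nbhs_dnbhs_neq.
      rewrite addr0 /GRing.scale /= mulr1 f0 subr0 -ler_norml normrM.
      rewrite (ger0_norm (flat_ge0 _ _)) normfV ler_pdivrMl ?normr_gt0 //.
      apply: le_trans (flat_le m h) _.
      by rewrite [leRHS]mulrCA -normrM -[h * h]expr2 ger0_norm ?sqr_ge0.
    - rewrite -[X in _ --> X]oppr0; apply: cvgN.
      rewrite -[X in _ --> X](mulr0 ((m.+2)`!%:R)); apply: cvgM; first exact: cvg_cst.
      rewrite -[X in _ --> X](@normr0 _ R); apply: cvg_norm; exact: nbhs_dnbhs.
    - rewrite -[X in _ --> X](mulr0 ((m.+2)`!%:R)); apply: cvgM; first exact: cvg_cst.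
      rewrite -[X in _ --> X](@normr0 _ R); apply: cvg_norm; exact: nbhs_dnbhs.
  move=> h; apply: DeriveDef; first by apply/cvg_ex; exists 0.
  exact/cvg_lim.
Unshelve. all: by end_near. Qed.

Lemma continuous_flat m : continuous (flat m).
Proof.
by move=> t; apply/differentiable_continuous/derivable1_diffP; have [] := is_derive_flat m t.
Qed.

Lemma Ck_flat n k m (c a : R) (i : 'I_n) :
  Ck k (fun x : 'rV[R]_n => flat m (c * (x ord0 i - a))).
Proof.
have caff : Ck k.+1 (fun x : 'rV[R]_n => c * (x ord0 i - a)).
  by apply: CkZ; apply: CkD; [exact: Ck_coord|exact: Ck_cst].
elim: k m {caff} (caff) => [|k IH] m caff.
  split => // x; apply: (@continuous_comp _ _ _ (fun x : 'rV[R]_n => c * (x ord0 i - a))).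
    exact: (Ck_continuous caff).
  exact: continuous_flat.
apply: (@CkS _ _ _ _ (fun j x => (flat m.+2 (c * (x ord0 i - a)) + - m%:R *
   flat m.+1 (c * (x ord0 i - a))) *
   pderiv (fun x : 'rV[R]_n => c * (x ord0 i - a)) j x)) => [x|j x|j].
- apply: (@continuous_comp _ _ _ (fun x : 'rV[R]_n => c * (x ord0 i - a))).
    exact: (Ck_continuous caff).
  exact: continuous_flat.
- rewrite mulNr.
  exact: (is_derive_comp1 (is_derive_flat m _) (Ck_is_derive j x caff)).
- apply: CkM; last by apply/CkW/(Ck_pderiv _ caff).
  by apply: CkD; [|apply: CkZ]; apply: IH; exact: CkW.
Qed.

End flat_functions.

(** * Integration by parts *)

Section integration_by_parts.
Context {R : realType}.

Lemma closed_cbox n (a b : 'I_n -> R) : closed (cbox a b).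
Proof. by apply: compact_closed; [exact: norm_hausdorff|exact: compact_cbox]. Qed.

Lemma pderiv_outside n (f : 'rV[R]_n -> R) (i : 'I_n) (K : set 'rV[R]_n) :
  closed K -> (forall x, ~ K x -> f x = 0) -> forall x, ~ K x -> pderiv f i x = 0.
Proof.
move=> cK f0 x Kx; rewrite /pderiv.
transitivity ('D_(delta_mx ord0 i) (cst 0 : 'rV[R]_n -> R) x); last exact: derive_cst.
apply: near_eq_derive.
have : nbhs x (~` K) by apply: open_nbhs_nbhs; split => //; exact: closed_openC.
by apply: filterS => y Ky; rewrite f0.
Qed.

Lemma continuous_bounded_cbox n (g : 'rV[R]_n -> R) (a b : 'I_n -> R) :
  continuous g -> exists2 C, 0 <= C & forall x, cbox a b x -> `|g x| <= C.
Proof.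
move=> cg.
have : compact (g @` cbox a b).
  by apply: continuous_compact; [exact: continuous_subspaceT|exact: compact_cbox].
move=> /compact_bounded[M [_ MP]]; exists (Num.max M 0 + 1).
  by rewrite addr_ge0 // le_max lexx orbT.
move=> x xab; apply: (MP (Num.max M 0 + 1)).
  by rewrite ltr_pwDr // le_max lexx.
by exists x.
Qed.

Lemma continuous_integrable_cbox n (g : 'rV[R]_n -> R) (a b : 'I_n -> R) :
  continuous g -> (forall x, ~ cbox a b x -> g x = 0) ->
  (lebesgue_rV R n).-integrable setT (EFin \o g).
Proof.
move=> cg g0.
have -> : EFin \o g = (EFin \o g) \_ (cbox a b).
  apply/funext => x; rewrite patchE; case: ifPn => //= /negP xab.
  by rewrite g0 // => /mem_set.
rewrite -integrable_mkcond; last exact: measurable_cbox.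
apply: measurable_bounded_integrable.
- exact: measurable_cbox.
- exact: lebesgue_cbox_lty.
- by apply: measurable_funTS; exact: continuous_rV_measurable.
have [C C0 gC] := continuous_bounded_cbox a b cg.
by exists C; split; [exact: num_real|move=> M CM x /gC /le_trans; apply; exact: ltW].
Qed.

Lemma integral_derive_csupp (h h' : R -> R) (M : R) : 0 < M ->
  (forall t : R, is_derive t 1 h (h' t)) -> continuous h' ->
  (forall t, M < `|t| -> h t = 0) ->
  (forall t, M < `|t| -> h' t = 0) ->
  (\int[lebesgue_measure]_t (h' t)%:E = 0)%E.
Proof.
move=> M0 dh ch h0 h'0.
have ch0 : continuous h.
  by move=> t; apply/differentiable_continuous/derivable1_diffP; have [] := dh t.
transitivity (\int[lebesgue_measure]_(t in `[(- (M + 1))%R, (M + 1)%R]%classic) (h' t)%:E)%E.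
  rewrite [RHS]integral_mkcond; apply: eq_integral => t _.
  rewrite patchE; case: ifPn => // /negP tM; rewrite h'0 //.
  rewrite ltNge; apply/negP => tM'; apply: tM; rewrite inE /= in_itv /= -ler_norml.
  by apply: le_trans tM' _; lra.
rewrite (continuous_FTC2 (F := h)).
- have MM : M < `|M + 1| by rewrite gtr0_norm; lra.
  by rewrite !h0 ?normrN // -EFinB subrr.
- lra.
- exact: continuous_subspaceT.
- split.
  + by move=> t _; have [] := dh t.
  + by apply: cvg_at_right_filter; exact: ch0.
  + by apply: cvg_at_left_filter; exact: ch0.
- by move=> t _; rewrite derive1E derive_val.
Qed.

Lemma continuous_rV_consr n (t : R) : continuous (fun y : 'rV[R]_n => rV_cons (t, y)).
Proof.
move=> y A /nbhs_ballP[e /= e0 eA]; apply/nbhs_ballP; exists e => //= z [_ yz].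
apply: eA; split => // i j; rewrite !mxE; case: (unlift ord0 j) => [k|] /=.
  exact: yz.
exact: ballxx.
Qed.

Lemma continuous_rV_consl n (y : 'rV[R]_n) : continuous (fun t : R => rV_cons (t, y)).
Proof.
move=> t A /nbhs_ballP[e /= e0 eA]; apply/nbhs_ballP; exists e => //= z tz.
apply: eA; split => // i j; rewrite !mxE; case: (unlift ord0 j) => [k|] //=.
exact: ballxx.
Qed.

Lemma rV_cons_shift0 n (h t : R) (y : 'rV[R]_n) :
  rV_cons (h + t, y) = h *: delta_mx ord0 ord0 + rV_cons (t, y).
Proof.
apply/rowP => j; rewrite !mxE; case: (unliftP ord0 j) => [k ->|->] /=.
  by rewrite mulr0 add0r.
by rewrite mulr1.
Qed.

Lemma rV_cons_shiftS n (h t : R) (y : 'rV[R]_n) (i : 'I_n) :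
  rV_cons (t, h *: delta_mx ord0 i + y) =
  h *: delta_mx ord0 (lift ord0 i) + rV_cons (t, y).
Proof.
apply/rowP => j; rewrite !mxE; case: (unliftP ord0 j) => [k ->|->] /=.
  by rewrite !mxE /= (inj_eq lift_inj).
by rewrite mulr0 add0r.
Qed.

Lemma cbox_rV_cons n (M t : R) (y : 'rV[R]_n) :
  cbox (fun=> - M) (fun=> M) (rV_cons (t, y)) <->
  `|t| <= M /\ cbox (fun=> - M) (fun=> M) y.
Proof.
split=> [tyM|[tM yM] i].
  split; first by have := tyM ord0; rewrite mxE unlift_none /= -ler_norml.
  by move=> i; have := tyM (lift ord0 i); rewrite mxE liftK.
rewrite mxE; case: (unlift ord0 i) => [k|] /=; first exact: yM.
by rewrite -ler_norml.
Qed.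

(** By Fubini, one may integrate first along the differentiated coordinate,
    where the claim is the fundamental theorem of calculus. The induction
    follows the construction of Lebesgue measure as an iterated product: the
    derivative is either along the first coordinate or along one of the others. *)
Lemma integral_pderiv n (i : 'I_n) (f : 'rV[R]_n -> R) (M : R) : 0 < M ->
  (forall x, derivable f x (delta_mx ord0 i)) -> continuous (pderiv f i) ->
  (forall x, ~ cbox (fun=> - M) (fun=> M) x -> f x = 0) ->
  (\int[lebesgue_rV R n]_x (pderiv f i x)%:E = 0)%E.
Proof.
move=> M0; elim: n i f => [[]//|n IH] i f df cdf f0.
have g0 : forall x, ~ cbox (fun=> - M) (fun=> M) x -> pderiv f i x = 0.
  by apply: pderiv_outside => //; exact: closed_cbox.
have /measurable_EFinP mg : measurable_fun [set: 'rV[R]_n.+1] (pderiv f i).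
  exact: continuous_rV_measurable.
have intg := continuous_integrable_cbox cdf g0.
pose P := (@lebesgue_measure R \x lebesgue_rV R n)%E.
have intc : P.-integrable setT ((EFin \o pderiv f i) \o @rV_cons R n).
  apply/integrableP; split.
    by apply: measurableT_comp => //; exact: measurable_rV_cons.
  have /integrableP[_] := intg.
  rewrite [X in (X < _)%E](_ : _ = \int[P]_x
     ((abse \o (EFin \o pderiv f i)) \o @rV_cons R n) x)%E //.
  rewrite -(@ge0_integral_pushforward _ _ _ _ _ _ (@measurable_rV_cons R n) P setT) //.
    exact: measurableT_comp.
  by move=> y _; exact: abse_ge0.
transitivity (\int[P]_z ((EFin \o pderiv f i) \o @rV_cons R n) z)%E.
  rewrite -(@integral_pushforward _ _ _ _ _ _ (@measurable_rV_cons R n) P setT) //.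
have [j|] := unliftP ord0 i; move=> iE.
- rewrite -integral12_prod_meas1 //; apply: integral0_eq => t _.
  rewrite /fubini_F /=.
  have line y (h : R) : f (rV_cons (t, h *: delta_mx ord0 j + y)) =
       f (h *: delta_mx ord0 i + rV_cons (t, y)) by rewrite rV_cons_shiftS iE.
  have dE y : is_derive y (delta_mx ord0 j) (fun y => f (rV_cons (t, y)))
      (pderiv f i (rV_cons (t, y))).
    apply/is_derive_line; under eq_fun do rewrite line.
    apply: (proj1 (is_derive_line f (rV_cons (t, y)) (delta_mx ord0 i) _)); exact: (DeriveDef (df _) erefl).
  have pE : pderiv (fun y => f (rV_cons (t, y))) j =
      fun y => pderiv f i (rV_cons (t, y)).
    by apply/funext => y; rewrite /pderiv derive_val.
  transitivity (\int[lebesgue_rV R n]_y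
      (pderiv (fun y => f (rV_cons (t, y))) j y)%:E)%E; first by rewrite pE.
  apply: IH.
  + by move=> y; have [] := dE y.
  + rewrite pE => y; apply: (@continuous_comp _ _ _ (fun y => rV_cons (t, y)) (pderiv f i)).
      exact: continuous_rV_consr.
    exact: cdf.
  + by move=> y yM; apply: f0 => /cbox_rV_cons[].
- rewrite -integral21_prod_meas1 //; apply: integral0_eq => y _.
  rewrite /fubini_G /=.
  have dE (t : R) : is_derive t 1 (fun t => f (rV_cons (t, y)))
      (pderiv f i (rV_cons (t, y))).
    apply/is_derive_line.
    rewrite (_ : (fun h => _) = (fun h : R => f (h *: delta_mx ord0 i + rV_cons (t, y)))).
      apply: (proj1 (is_derive_line f (rV_cons (t, y)) (delta_mx ord0 i) _)); exact: (DeriveDef (df _) erefl).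
    by apply/funext => h; rewrite /GRing.scale /= mulr1 rV_cons_shift0 iE.
  apply: (integral_derive_csupp M0 dE).
  + move=> t; apply: (@continuous_comp _ _ _ (fun t => rV_cons (t, y)) (pderiv f i)).
      exact: continuous_rV_consl.
    exact: cdf.
  + by move=> t tM; apply: f0 => /cbox_rV_cons[]; rewrite leNgt tM.
  + by move=> t tM; apply: g0 => /cbox_rV_cons[]; rewrite leNgt tM.
Qed.

End integration_by_parts.

Section test_functions.
Context {R : realType} {n : nat}.
Variable Omega : set 'rV[R]_n.
Hypothesis oO : open Omega.
Hypothesis bO : bounded_set Omega.
Local Notation leb := (lebesgue_rV R n).

Let mO : measurable Omega. Proof. exact: open_rV_measurable. Qed.

Lemma test_function_outside phi x : test_function Omega phi -> ~ Omega x -> phi x = 0.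
Proof. by move=> [_ [K [cK KO K0]]] Ox; apply: K0 => /KO. Qed.

Lemma test_function_pderiv phi i :
  test_function Omega phi -> test_function Omega (pderiv phi i).
Proof.
move=> [sphi [K [cK KO K0]]]; split; first by move=> k; have /Ck_pderiv := sphi k.+1; exact.
exists K; split => //; apply: pderiv_outside => //.
by apply: compact_closed => //; exact: norm_hausdorff.
Qed.

(** There is no boundary term, since the product $f \phi$ vanishes near the
    boundary. Besides test functions, $f$ may be a coordinate. *)
Lemma test_function_parts (f phi : 'rV[R]_n -> R) i :
  Ck 1 f -> test_function Omega phi ->
  (\int[leb]_(x in Omega) (f x * pderiv phi i x)%:E =
   - \int[leb]_(x in Omega) (pderiv f i x * phi x)%:E)%E.
Proof.
move=> cf tphi; have [sphi [K [cK KO K0]]] := tphi.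
have [M [M0 OM]] := bounded_cbox bO.
have out x : ~ cbox (fun=> - M) (fun=> M) x -> ~ Omega x by move=> xM /OM.
have tdphi := test_function_pderiv i tphi.
have cphi : continuous phi := Ck_continuous (sphi 0%N).
have cdphi : continuous (pderiv phi i) := Ck_continuous (Ck_pderiv i (sphi 1%N)).
have cf0 := Ck_continuous cf.
have cdf := Ck_continuous (Ck_pderiv i cf).
have c1 : continuous (fun x => f x * pderiv phi i x).
  by move=> x; apply: (@continuousM _ _ f (pderiv phi i)); [exact: cf0|exact: cdphi].
have c2 : continuous (fun x => pderiv f i x * phi x).
  by move=> x; apply: (@continuousM _ _ (pderiv f i) phi); [exact: cdf|exact: cphi].
have i1 : leb.-integrable setT (EFin \o (fun x => f x * pderiv phi i x)).
  apply: continuous_integrable_cbox c1 _ => x /out Ox.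
  by rewrite (test_function_outside tdphi) // mulr0.
have i2 : leb.-integrable setT (EFin \o (fun x => pderiv f i x * phi x)).
  apply: continuous_integrable_cbox c2 _ => x /out Ox.
  by rewrite (test_function_outside tphi) // mulr0.
have dE x : is_derive x (delta_mx ord0 i) (fun x => f x * phi x)
    (f x * pderiv phi i x + pderiv f i x * phi x).
  rewrite [X in _ + X]mulrC.
  exact: (is_deriveM (Ck_is_derive i x cf) (Ck_is_derive i x (sphi 1%N))).
have pE : pderiv (fun x => f x * phi x) i =
    fun x => f x * pderiv phi i x + pderiv f i x * phi x.
  by apply/funext => x; rewrite /pderiv; exact: derive_val.
have : (\int[leb]_x (pderiv (fun x => f x * phi x) i x)%:E = 0)%E.
  apply: (integral_pderiv M0).
  - by move=> x; have [] := dE x.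
  - rewrite pE => x; apply: (@continuousD _ _ _ (fun x => f x * pderiv phi i x)
      (fun x => pderiv f i x * phi x)); [exact: c1|exact: c2].
  - by move=> x /out Ox; rewrite (test_function_outside tphi) // mulr0.
rewrite pE; under eq_integral do rewrite EFinD.
rewrite integralD //.
have ext (g : 'rV[R]_n -> R) : leb.-integrable setT (EFin \o g) ->
    (forall x, ~ Omega x -> g x = 0) -> exists2 r : R,
    (\int[leb]_(x in Omega) (g x)%:E = r%:E)%E & (\int[leb]_x (g x)%:E = r%:E)%E.
  move=> ig g0; exists (fine (\int[leb]_x (g x)%:E)%E).
    rewrite fineK; last exact: integrable_fin_num.
    rewrite integral_mkcond; apply: eq_integral => x _.
    by rewrite patchE; case: ifPn => // /negP xO; rewrite g0 // => /mem_set.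
  by rewrite fineK //; exact: integrable_fin_num.
have [|a -> ->] := ext _ i1.
  by move=> x Ox; rewrite (test_function_outside tdphi) // mulr0.
have [|b -> ->] := ext _ i2.
  by move=> x Ox; rewrite (test_function_outside tphi) // mulr0.
by rewrite -EFinD => -[/eqP]; rewrite addr_eq0 => /eqP ->; rewrite EFinN.
Qed.

End test_functions.

(** * The fundamental lemma of the calculus of variations *)

Section orthants.
Context {R : realType} {n : nat}.

Definition orthant (a : 'I_n -> R) : set 'rV[R]_n := [set x | forall i, a i < x ord0 i].
Definition orthants : set (set 'rV[R]_n) := range orthant.

Lemma measurable_orthant a : measurable (orthant a).
Proof.
apply: (@measurable_rV_pi R n (fun i => [set y | a i < y])) => i.
have -> : [set y | a i < y] = `]a i, +oo[%classic.
  by apply/seteqP; split => y /=; rewrite in_itv /= andbT.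
exact: measurable_itv.
Qed.

Lemma setI_closed_orthants : setI_closed orthants.
Proof.
move=> _ _ [a _ <-] [b _ <-]; exists (fun i => Num.max (a i) (b i)) => //.
apply/seteqP; split => x; rewrite /orthant /=.
  by move=> h; split => i; have := h i; rewrite gt_max => /andP[].
by move=> [ha hb] i; rewrite gt_max ha hb.
Qed.

(** The half-space $\{x_i > r\}$ is the increasing union of the orthants that
    have $r$ as $i$-th bound and $-k$ as the other ones. *)
Lemma measurable_rV_orthants : @measurable _ 'rV[R]_n = <<s orthants >>.
Proof.
apply/seteqP; split; last first.
  apply: smallest_sub; first exact: sigma_algebra_measurable.
  by move=> _ [a _ <-]; exact: measurable_orthant.
apply: smallest_sub; first exact: smallest_sigma_algebra.
rewrite -bigcup_seq => A [i _] [B mB <-].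
pose T := g_sigma_algebraType orthants.
have mi : measurable_fun [set: T] (fun x : T => (x : 'rV[R]_n) ord0 i).
  apply: (measurability _ (RGenOInfty.measurableE R)) => _ [_ [r ->] <-].
  rewrite (_ : _ `&` _ = \bigcup_k
      orthant (fun j => if j == i then r else - k%:R)).
    apply: bigcupT_measurable => k; apply: sub_sigma_algebra.
    by exists (fun j => if j == i then r else - k%:R).
  apply/seteqP; split => x /=.
    rewrite in_itv /= andbT => -[_ rx].
    have [M [M0 xM]] := bounded_cbox (compact_bounded (@compact_set1 _ x)).
    have := xM x erefl => {}xM.
    exists (Num.truncn M).+1 => // j /=; case: eqP => [-> //|_].
    have /andP[h _] := xM j; apply: lt_le_trans h.
    by rewrite ltrN2 truncnS_gt.
  move=> [k _] /(_ i); rewrite eqxx => rx; split => //.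
  by rewrite in_itv /= rx.
exact: mi.
Qed.

(** Orthants generate the Borel sets and are stable under intersection, so that
    Dynkin's lemma extends the hypothesis to the traces of all Borel sets. *)
Lemma ae_eq0_orthants (B : set 'rV[R]_n) (h : 'rV[R]_n -> R) (M : R) :
  measurable B -> B `<=` cbox (fun=> - M) (fun=> M) ->
  (lebesgue_rV R n).-integrable B (EFin \o h) ->
  (forall a, \int[lebesgue_rV R n]_(x in B `&` orthant a) (h x)%:E = 0)%E ->
  {ae lebesgue_rV R n, forall x, B x -> h x = 0}.
Proof.
move=> mB BM ih h0.
pose P (S : set 'rV[R]_n) := (\int[lebesgue_rV R n]_(x in B `&` S) (h x)%:E = 0)%E.
have PS S : measurable S -> P S.
  rewrite measurable_rV_orthants.
  have PT : P setT.
    rewrite /P setIT -[RHS](h0 (fun=> - (M + 1))); congr integral.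
    apply/seteqP; split => x; last by case.
    move=> Bx; split => // i; have /andP[xM _] := BM _ Bx i.
    by apply: lt_le_trans xM; rewrite ltrN2; lra.
  apply: dynkin_induction => //.
  - exact: measurable_rV_orthants.
  - exact: setI_closed_orthants.
  - by move=> _ [a _ <-]; exact: h0.
  - move=> A mA PA; rewrite /P.
    have : P setT by [].
    rewrite /P setIT -{1}(setUIDK B A).
    rewrite integral_setU.
    + by rewrite PA add0e setDE.
    + exact: measurableI.
    + exact: measurableD.
    + by rewrite setUIDK; exact: measurable_int ih.
    + by apply/disj_setPS => x [[_ Ax] [_]].
  - move=> F mF tF PF; rewrite /P setI_bigcupr integral_bigcup.
    + by apply: eseries0 => k _ _; exact: PF.
    + exact: trivIset_setIl.
    + by move=> k; exact: measurableI.
    + apply: integrableS ih => //; first by apply: bigcup_measurable => k _; exact: measurableI.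
      by move=> x [k _ []].
have := @integral_ae_eq _ _ _ (lebesgue_rV R n) B mB (cst 0%E) (EFin \o h) ih.
move=> /(_ (measurable_cst _)) H.
have : ae_eq (lebesgue_rV R n) B (EFin \o h) (cst 0%E).
  apply: H => E EB mE; rewrite integral0.
  by have := PS _ mE; rewrite /P setIidr.
by apply: filterS => x Hx /Hx [].
Qed.

End orthants.

Section fundamental_lemma.
Context {R : realType} {n : nat}.
Variable Omega : set 'rV[R]_n.
Hypothesis oO : open Omega.
Hypothesis bO : bounded_set Omega.
Local Notation leb := (lebesgue_rV R n).

Let mO : measurable Omega. Proof. exact: open_rV_measurable. Qed.

Lemma bounded_open_lty : (leb Omega < +oo)%E.
Proof.
have [M [M0 OM]] := bounded_cbox bO.
apply: le_lt_trans (lebesgue_cbox_lty (fun=> - M) (fun=> M)).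
by apply: le_measure OM; rewrite inE //; exact: measurable_cbox.
Qed.

Lemma test_function_bounded phi : test_function Omega phi ->
  exists2 C, 0 <= C & forall x, `|phi x| <= C.
Proof.
move=> tphi; have [sphi _] := tphi; have [M [M0 OM]] := bounded_cbox bO.
have [C C0 phiC] := continuous_bounded_cbox (fun=> - M) (fun=> M) (Ck_continuous (sphi 0%N)).
exists C => // x; have [Ox|Ox] := pselect (Omega x); first exact/phiC/OM.
by rewrite (test_function_outside tphi) // normr0.
Qed.

Lemma test_function_measurable phi D : test_function Omega phi -> measurable_fun D phi.
Proof.
by move=> [sphi _]; apply: measurable_funTS; exact: continuous_rV_measurable (Ck_continuous (sphi 0%N)).
Qed.

Lemma integrable_test_function (h : 'rV[R]_n -> R) phi : test_function Omega phi ->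
  leb.-integrable Omega (EFin \o h) ->
  leb.-integrable Omega (fun x => (h x * phi x)%:E).
Proof.
move=> tphi ih.
rewrite (_ : (fun x => _) = (EFin \o phi) \* (EFin \o h))%E; last first.
  by apply/funext => x /=; rewrite mulrC EFinM.
apply: integrableMr => //; first exact: test_function_measurable.
have [C C0 phiC] := test_function_bounded tphi.
by exists C; split; [exact: num_real|move=> M CM x _; exact: le_trans (phiC x) (ltW CM)].
Qed.

(** As $k$ grows, these increase to the indicator of the box with corners $a$
    and $b$. *)
Definition bump (a b : 'I_n -> R) (k : nat) (x : 'rV[R]_n) : R :=
  \prod_(i <- index_enum 'I_n)
    (flat 0 (k.+1%:R * (x ord0 i - a i)) * flat 0 (- k.+1%:R * (x ord0 i - b i))).

Lemma flat0_le1 (t : R) : flat 0 t <= 1.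
Proof.
rewrite /flat; case: ifP => // t0; rewrite expr0 invr1 mul1r -expR0 ler_expR.
by rewrite oppr_le0 invr_ge0 ltW.
Qed.

Lemma flat0_cvg (t : R) : 0 < t -> flat 0 (k.+1%:R * t) @[k --> \oo] --> (1 : R).
Proof.
move=> t0; rewrite (_ : (fun k => _) = expR \o (fun k => - (k.+1%:R^-1 * t^-1))); last first.
  apply/funext => k /=; rewrite /flat ifT ?mulr_gt0 //.
  by rewrite expr0 invr1 mul1r invfM.
rewrite -[X in _ --> X]expR0; apply: continuous_cvg; first exact: continuous_expR.
rewrite -[X in _ --> X]oppr0; apply: cvgN; rewrite -(mul0r t^-1).
apply: cvgM; [exact: cvg_harmonic|exact: cvg_cst].
Qed.

Lemma bump_cvg a b x : obox a b x -> bump a b k x @[k --> \oo] --> (1 : R).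
Proof.
move=> xab; rewrite /bump; elim: (index_enum 'I_n) => [|i r IH].
  by under eq_fun do rewrite big_nil; exact: cvg_cst.
under eq_fun do rewrite big_cons.
have /andP[ax xb] := xab i.
have c1 : flat 0 (k.+1%:R * (x ord0 i - a i)) @[k --> \oo] --> (1 : R).
  by apply: flat0_cvg; rewrite subr_gt0.
have c2 : flat 0 (- k.+1%:R * (x ord0 i - b i)) @[k --> \oo] --> (1 : R).
  under eq_fun do rewrite mulNr -mulrN opprB.
  by apply: flat0_cvg; rewrite subr_gt0.
have := cvgM (cvgM c1 c2) IH; rewrite !mulr1; exact.
Qed.

Lemma bump_eq0 a b k x : ~ obox a b x -> bump a b k x = 0.
Proof.
move=> /existsNP[i /negP]; rewrite negb_and -!leNgt => xi.
rewrite /bump (bigD1_seq i) ?mem_index_enum ?index_enum_uniq //=.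
rewrite [X in X * _](_ : _ = 0) ?mul0r //.
case/orP: xi => xi; rewrite /flat.
  by rewrite ifF ?mul0r // ltNge pmulr_rle0 // subr_le0 xi.
by rewrite [X in _ * X]ifF ?mulr0 // ltNge mulNr oppr_le0 mulr_ge0 // subr_ge0.
Qed.

Lemma bump_le1 a b k x : `|bump a b k x| <= 1.
Proof.
rewrite ger0_norm; last by apply: prodr_ge0 => i _; rewrite mulr_ge0 ?flat_ge0.
rewrite -[leRHS](@big1_eq _ _ *%R _ (index_enum 'I_n) predT).
by apply: ler_prod => i _; rewrite mulr_ge0 ?flat_ge0 // mulr_ile1 ?flat_ge0 ?flat0_le1.
Qed.

Lemma test_function_bump a b k : cbox a b `<=` Omega -> test_function Omega (bump a b k).
Proof.
move=> abO; split.
  by move=> j; apply: Ck_prod => i; apply: CkM; exact: Ck_flat.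
exists (cbox a b); split => //; first exact: compact_cbox.
move=> x xab; apply: bump_eq0 => xo; apply: xab => i.
by have /andP[/ltW -> /ltW ->] := xo i.
Qed.

Lemma integral_obox_eq0 (h : 'rV[R]_n -> R) a b :
  leb.-integrable Omega (EFin \o h) ->
  (forall phi, test_function Omega phi ->
    \int[leb]_(x in Omega) (h x * phi x)%:E = 0)%E ->
  cbox a b `<=` Omega -> (\int[leb]_(x in obox a b) (h x)%:E = 0)%E.
Proof.
move=> ih h0 abO.
have oabO : obox a b `<=` Omega.
  by move=> x xab; apply: abO => i; have /andP[/ltW -> /ltW ->] := xab i.
have mh : measurable_fun Omega h by apply/measurable_EFinP; exact: measurable_int ih.
have tb k := test_function_bump k abO.
have := @dominated_cvg _ _ _ leb Omega mO
  (fun k x => (h x * bump a b k x)%:E) ((EFin \o h) \_ (obox a b))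
  (fun x => `|h x|%:E).
have -> : (fun k => \int[leb]_(x in Omega) (h x * bump a b k x)%:E)%E = cst 0%E.
  by apply/funext => k; exact: h0.
move=> H.
have E : (\int[leb]_(x in Omega) ((EFin \o h) \_ (obox a b)) x = 0)%E.
  apply/esym; apply: (@cvg_unique _ (@ereal_hausdorff R) (cst 0%E @ \oo)).
    exact: cvg_cst.
  apply: H => //.
  - move=> k; apply/measurable_EFinP/measurable_funM => //.
    exact: test_function_measurable (tb k).
  - move=> x _; rewrite patchE; case: ifPn => [|/negP xab].
      rewrite inE => xab; apply: cvg_EFin; first by apply: nearW.
      rewrite -[X in _ --> X]mulr1; apply: cvgM; first exact: cvg_cst.
      exact: bump_cvg.
    apply: cvg_near_cst; apply: nearW => k.
    by rewrite bump_eq0 ?mulr0 // => /mem_set.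
  - exact: integrable_norm ih.
  - move=> k x _; rewrite /= lee_fin normrM ler_piMr //; exact: bump_le1.
move: E; rewrite [X in X = _](_ : _ = \int[leb]_(x in obox a b) (h x)%:E)%E //.
by rewrite -integral_mkcondr (setIidr oabO).
Qed.

(** Testing with the functions [bump] shows that $h$ has zero integral over
    every box in $\Omega$. The trace of an orthant on a box is a box, so that
    [ae_eq0_orthants] applies on each box. *)
Lemma fundamental_lemma (h : 'rV[R]_n -> R) :
  leb.-integrable Omega (EFin \o h) ->
  (forall phi, test_function Omega phi ->
    \int[leb]_(x in Omega) (h x * phi x)%:E = 0)%E ->
  {ae leb, forall x, Omega x -> h x = 0}.
Proof.
move=> ih h0; apply: ae_open_obox => // a b abO.
have oabO : obox a b `<=` Omega.
  by move=> x xab; apply: abO => i; have /andP[/ltW -> /ltW ->] := xab i.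
have [M [M0 OM]] := bounded_cbox bO.
apply: (@ae_eq0_orthants _ _ _ _ M).
- exact: measurable_obox.
- exact: subset_trans oabO OM.
- by apply: integrableS ih => //; exact: measurable_obox.
move=> c; rewrite (_ : _ `&` _ = obox (fun i => Num.max (a i) (c i)) b); last first.
  apply/seteqP; split => x /=.
    by move=> [xab xc] i; rewrite gt_max; have /andP[-> ->] := xab i; rewrite xc.
  move=> xabc; split => i; have := xabc i; rewrite gt_max => /andP[/andP[h1 h2] h3] //.
  by rewrite h1 h3.
apply: integral_obox_eq0 => //; apply: subset_trans abO => x xabc i.
have := xabc i; rewrite ge_max => /andP[/andP[h1 h2] h3].
by rewrite h1 h3.
Qed.

End fundamental_lemma.

(** * Weak gradients and the spaces $W^{1,p}$ and $W_0^{1,p}$ *)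

Section euclidean_norm.
Context {R : realType} {n : nat}.
Implicit Types x y : 'rV[R]_n.

Lemma enorm_ge0 x : 0 <= enorm x. Proof. exact: sqrtr_ge0. Qed.

Lemma enorm_sqr x : enorm x ^+ 2 = dotrV x x.
Proof.
rewrite /enorm sqr_sqrtr; first by apply: eq_bigr => i _; rewrite expr2.
by apply: sumr_ge0 => i _; exact: sqr_ge0.
Qed.

Lemma enorm_eq0 x : enorm x = 0 -> x = 0.
Proof.
move=> x0; apply/rowP => i; rewrite mxE; have : dotrV x x = 0.
  by rewrite -enorm_sqr x0 expr0n.
move=> /eqP; rewrite /dotrV psumr_eq0 => [/allP/(_ i)|j _]; last first.
  by rewrite -expr2 sqr_ge0.
by rewrite mem_index_enum => /(_ isT); rewrite mulf_eq0 orbb => /eqP.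
Qed.

(** Cauchy-Schwarz, from the square of $|y| x - |x| y$. *)
Lemma dotrV_le x y : dotrV x y <= enorm x * enorm y.
Proof.
have [x0|x0] := eqVneq (enorm x) 0.
  rewrite x0 mul0r (enorm_eq0 x0) /dotrV big1 // => i _.
  by rewrite mxE mul0r.
have xp : 0 < enorm x by rewrite lt_def x0 enorm_ge0.
have [y0|y0] := eqVneq (enorm y) 0.
  rewrite y0 mulr0 (enorm_eq0 y0) /dotrV big1 // => i _.
  by rewrite mxE mulr0.
have yp : 0 < enorm y by rewrite lt_def y0 enorm_ge0.
have : 0 <= \sum_i (enorm y * x ord0 i - enorm x * y ord0 i) ^+ 2.
  by apply: sumr_ge0 => i _; exact: sqr_ge0.
rewrite (_ : \sum_i _ = enorm y ^+ 2 * dotrV x x + enorm x ^+ 2 * dotrV y y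
   - 2 * (enorm x * enorm y) * dotrV x y); last first.
  rewrite /dotrV !mulr_sumr -big_split /= -sumrB; apply: eq_bigr => i _; ring.
rewrite -!enorm_sqr.
have xyp : 0 < 2 * (enorm x * enorm y) by rewrite !mulr_gt0.
move=> h; rewrite -(ler_pM2l xyp); move: h; nra.
Qed.

Lemma dotrV_abs_le x y : `|dotrV x y| <= enorm x * enorm y.
Proof.
rewrite ler_norml dotrV_le andbT lerNl.
have -> : - dotrV x y = dotrV (- x) y.
  by rewrite /dotrV -sumrN; apply: eq_bigr => i _; rewrite mxE mulNr.
apply: le_trans (dotrV_le _ _) _; rewrite le_eqVlt; apply/orP; left; apply/eqP.
by congr (Num.sqrt _ * _); apply: eq_bigr => i _; rewrite mxE sqrrN.
Qed.

Lemma enormZ (c : R) x : enorm (c *: x) = `|c| * enorm x.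
Proof.
rewrite /enorm -sqrtr_sqr -sqrtrM ?sqr_ge0 //; congr Num.sqrt.
by rewrite mulr_sumr; apply: eq_bigr => i _; rewrite mxE exprMn.
Qed.

Lemma enormD x y : enorm (x + y) <= enorm x + enorm y.
Proof.
rewrite -(@ler_pXn2r _ 2) ?nnegrE ?addr_ge0 ?enorm_ge0 //.
rewrite sqrrD !enorm_sqr.
have -> : dotrV (x + y) (x + y) = dotrV x x + dotrV x y *+ 2 + dotrV y y.
  rewrite /dotrV -sumrMnl -!big_split /=; apply: eq_bigr => i _; rewrite !mxE; ring.
by rewrite lerD2r lerD2l lerMn2r /= dotrV_le.
Qed.

Lemma enorm0 : enorm (0 : 'rV[R]_n) = 0.
Proof. by rewrite -(scale0r 0) enormZ normr0 mul0r. Qed.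

Lemma coord_le_enorm x i : `|x ord0 i| <= enorm x.
Proof.
rewrite -sqrtr_sqr; apply: ler_wsqrtr; rewrite (bigD1 i) //= lerDl.
by apply: sumr_ge0 => j _; exact: sqr_ge0.
Qed.

Lemma measurable_enorm d (T : measurableType d) (D : set T) (g : T -> 'rV[R]_n) :
  (forall i, measurable_fun D (fun t => g t ord0 i)) ->
  measurable_fun D (fun t => enorm (g t)).
Proof.
move=> mg; rewrite /enorm.
apply: measurableT_comp; first by apply: continuous_measurable_fun; exact: sqrt_continuous.
by apply: measurable_sum => i; exact: measurable_funX.
Qed.

Lemma measurable_dotrV d (T : measurableType d) (D : set T) (g h : T -> 'rV[R]_n) :
  (forall i, measurable_fun D (fun t => g t ord0 i)) ->
  (forall i, measurable_fun D (fun t => h t ord0 i)) ->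
  measurable_fun D (fun t => dotrV (g t) (h t)).
Proof.
move=> mg mh; rewrite /dotrV.
by apply: measurable_sum => i; exact: measurable_funM.
Qed.

End euclidean_norm.

Lemma measurable_fun_powR {R : realType} d (T : measurableType d) (D : set T)
    (f : T -> R) (r : R) : measurable_fun D f -> measurable_fun D (fun x => f x `^ r).
Proof. by move=> mf; exact: (measurableT_comp (measurable_powR r) mf). Qed.

Section sobolev_spaces.
Context {R : realType} {n : nat}.
Variable p : R.
Hypothesis p1 : 1 < p.
Variable Omega : set 'rV[R]_n.
Hypothesis oO : open Omega.
Hypothesis bO : bounded_set Omega.
Local Notation leb := (lebesgue_rV R n).

Let mO : measurable Omega. Proof. exact: open_rV_measurable. Qed.
Let p0 : p != 0. Proof. by rewrite gt_eqF // (lt_trans ltr01). Qed.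

Lemma in_Lp_integrable v : in_Lp p Omega v -> leb.-integrable Omega (EFin \o v).
Proof.
move=> [mv vp].
have mvp : measurable_fun Omega (fun x => `|v x| `^ p).
  by apply: measurable_fun_powR; exact: measurableT_comp.
apply: (@le_integrable _ _ _ _ _ mO _ (fun x => 1%:E + (`|v x| `^ p)%:E)%E).
- exact/measurable_EFinP.
- move=> x _; rewrite -EFinD /= lee_fin [leRHS]ger0_norm ?addr_ge0 ?powR_ge0 //.
  have [v1|v1] := leP `|v x| 1; first by rewrite (le_trans v1) // lerDl powR_ge0.
  by rewrite (le_trans (le1r_powR (ltW v1) (ltW p1))) // lerDr.
- apply: integrableD => //.
    apply/integrableP; split; first exact: measurable_cst.
    rewrite (eq_integral (cst 1%E)) => [|x _]; last by rewrite /= normr1.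
    by rewrite integral_cst // mul1e bounded_open_lty.
  apply/integrableP; split; first exact/measurable_EFinP.
  rewrite (eq_integral (fun x => (`|v x| `^ p)%:E)) // => x _.
  by rewrite /= ger0_norm ?powR_ge0.
Qed.

Lemma in_Lp_bounded (v : 'rV[R]_n -> R) (C : R) : measurable_fun Omega v ->
  (forall x, Omega x -> `|v x| <= C) -> in_Lp p Omega v.
Proof.
move=> mv vC; split => //.
apply: (@le_lt_trans _ _ (\int[leb]_(x in Omega) (cst (C `^ p)%:E) x)%E).
  apply: ge0_le_integral => //.
  - by apply/measurable_EFinP; apply: measurable_fun_powR; exact: measurableT_comp.
  - move=> x Ox; rewrite lee_fin; apply: ge0_ler_powR; rewrite ?nnegrE //.
    + by rewrite ltW // (lt_trans ltr01).
    + exact: le_trans (vC x Ox).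
    + exact: vC.
rewrite integral_cst //; apply: lte_mul_pinfty => //.
- by rewrite lee_fin powR_ge0.
- exact: bounded_open_lty.
Qed.

Lemma in_LpZ c v : in_Lp p Omega v -> in_Lp p Omega (fun x => c * v x).
Proof.
move=> [mv vp]; split; first exact: measurable_funM.
under eq_integral do rewrite normrM powRM // EFinM.
rewrite ge0_integralZl_EFin ?powR_ge0 //.
- by apply: lte_mul_pinfty => //; rewrite lee_fin; exact: powR_ge0.
- by apply/measurable_EFinP; apply: measurable_fun_powR; exact: measurableT_comp.
Qed.

(** The difference of the two gradients is orthogonal to all test functions.
    Everything that is computed about the chosen gradient [grad], such as its
    behaviour under scaling, goes through this uniqueness. *)
Lemma weak_gradient_unique v g g' : weak_gradient p Omega v g ->
  weak_gradient p Omega v g' -> {ae leb, forall x, Omega x -> g x = g' x}.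
Proof.
move=> [Lg ig] [Lg' ig'].
have comp i : {ae leb, forall x, Omega x -> g x ord0 i - g' x ord0 i = 0}.
  have ii := in_Lp_integrable (Lg i); have ii' := in_Lp_integrable (Lg' i).
  apply: (fundamental_lemma oO bO (h := fun x => g x ord0 i - g' x ord0 i)).
    have := integrableB mO ii ii'; apply: eq_integrable => // x _ /=.
  move=> phi tphi.
  under eq_integral do rewrite mulrBl EFinB.
  have iphi := integrable_test_function oO bO tphi ii.
  have iphi' := integrable_test_function oO bO tphi ii'.
  have E : (\int[leb]_(x in Omega) (g x ord0 i * phi x)%:E =
            \int[leb]_(x in Omega) (g' x ord0 i * phi x)%:E)%E.
    by apply: oppe_inj; rewrite -ig // -ig'.
  by rewrite integralB // E subee //; exact: integrable_fin_num.
have : \forall x \ae leb, forall i, Omega x -> g x ord0 i - g' x ord0 i = 0.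
  exact: filter_forall comp.
apply: filterS => x gx Ox; apply/rowP => i; apply/eqP.
by rewrite -subr_eq0 gx.
Qed.

Lemma gradP v : W1p p Omega v -> weak_gradient p Omega v (grad p Omega v).
Proof. by move=> [_ [g vg]]; exact: (@xgetI _ _ [set g | weak_gradient p Omega v g] g). Qed.

Lemma ae_grad v g : weak_gradient p Omega v g ->
  {ae leb, forall x, Omega x -> grad p Omega v x = g x}.
Proof.
move=> vg; apply: (weak_gradient_unique _ vg).
exact: (@xgetI _ _ [set g | weak_gradient p Omega v g] g). Qed.

Lemma measurable_grad v i : W1p p Omega v ->
  measurable_fun Omega (fun x => grad p Omega v x ord0 i).
Proof. by move=> /gradP[/(_ i)[]]. Qed.

Lemma weak_gradient_test_function phi : test_function Omega phi ->
  weak_gradient p Omega phi (cgrad phi).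
Proof.
move=> tphi; split=> [i|psi i tpsi].
  have tdphi := test_function_pderiv i tphi.
  have [C C0 phiC] := test_function_bounded bO tdphi.
  rewrite /cgrad; under eq_fun do rewrite mxE.
  by apply: (in_Lp_bounded (C := C)) => //; exact: test_function_measurable tdphi.
rewrite (test_function_parts bO) //; last by case: tphi.
by under [in RHS]eq_integral do rewrite mxE.
Qed.

Lemma in_Lp_test_function phi : test_function Omega phi -> in_Lp p Omega phi.
Proof.
move=> tphi; have [C C0 phiC] := test_function_bounded bO tphi.
by apply: (in_Lp_bounded (C := C)) => //; exact: test_function_measurable tphi.
Qed.

Lemma measurable_cgrad phi i D : test_function Omega phi ->
  measurable_fun D (fun x => cgrad phi x ord0 i).
Proof.
move=> tphi; rewrite /cgrad; under eq_fun do rewrite mxE.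
exact: test_function_measurable (test_function_pderiv i tphi).
Qed.

Lemma integral_enorm_ae (g h : 'rV[R]_n -> 'rV[R]_n) : (forall i, measurable_fun Omega (fun x => g x ord0 i)) ->
  (forall i, measurable_fun Omega (fun x => h x ord0 i)) ->
  {ae leb, forall x, Omega x -> g x = h x} ->
  (\int[leb]_(x in Omega) (enorm (g x) `^ p)%:E =
   \int[leb]_(x in Omega) (enorm (h x) `^ p)%:E)%E.
Proof.
move=> mg mh gh; apply: ae_eq_integral => //.
- by apply/measurable_EFinP/measurable_fun_powR/measurable_enorm.
- by apply/measurable_EFinP/measurable_fun_powR/measurable_enorm.
- by apply: filterS gh => x gh /gh ->.
Qed.

(** The constant sequence approximates, since [grad] agrees with the classical
    gradient almost everywhere. *)
Lemma W01p_test_function phi : test_function Omega phi -> W01p p Omega phi.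
Proof.
move=> tphi; have wg := weak_gradient_test_function tphi.
have W1 : W1p p Omega phi.
  by split; [exact: in_Lp_test_function|exists (cgrad phi)].
split => //; exists (fun=> phi); split => //.
- rewrite (_ : (fun k => _) = cst 0%E); first exact: cvg_cst.
  apply/funext => k; apply: integral0_eq => x _.
  by rewrite subrr normr0 powR0.
- rewrite (_ : (fun k => _) = cst 0%E); first exact: cvg_cst.
  apply/funext => k.
  rewrite (@integral_enorm_ae _ (fun=> 0)).
  + by apply: integral0_eq => x _; rewrite enorm0 powR0.
  + move=> i; under eq_fun do rewrite !mxE.
    apply: measurable_funB; last exact: measurable_grad.
    exact: test_function_measurable (test_function_pderiv i tphi).
  + by move=> i; under eq_fun do rewrite mxE; exact: measurable_cst.
  + by apply: filterS (ae_grad wg) => x gx Ox; rewrite gx // subrr.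
Qed.

Lemma weak_gradientZ c v g : in_Lp p Omega v -> weak_gradient p Omega v g ->
  weak_gradient p Omega (fun x => c * v x) (fun x => c *: g x).
Proof.
move=> Lv [Lg ig]; split=> [i|phi i tphi].
  by under eq_fun do rewrite mxE; exact: in_LpZ.
under eq_integral do rewrite -mulrA EFinM.
rewrite integralZl //; last first.
  apply: integrable_test_function => //; last exact: in_Lp_integrable.
  exact: test_function_pderiv.
under [in RHS]eq_integral do rewrite mxE -mulrA EFinM.
rewrite integralZl //; last first.
  by apply: integrable_test_function => //; exact: in_Lp_integrable.
by rewrite ig // muleN.
Qed.

Lemma test_functionZ c phi : test_function Omega phi ->
  test_function Omega (fun x => c * phi x).
Proof.
move=> [sphi [K [cK KO K0]]]; split; first by move=> k; exact/CkZ/sphi.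
by exists K; split => // x Kx; rewrite K0 // mulr0.
Qed.

Lemma cgradZ c phi x : test_function Omega phi ->
  cgrad (fun x => c * phi x) x = c *: cgrad phi x.
Proof.
move=> [sphi _]; apply/rowP => i; rewrite !mxE /pderiv.
have [d1 _] := Ck_is_derive i x (sphi 1%N).
by rewrite -[LHS]/('D_(delta_mx ord0 i) (c \*: phi) x) deriveZ.
Qed.

Lemma ae_gradZ c v : W1p p Omega v ->
  {ae leb, forall x, Omega x -> grad p Omega (fun x => c * v x) x = c *: grad p Omega v x}.
Proof.
by move=> W1; apply: ae_grad; apply: weak_gradientZ; [case: W1|exact: gradP].
Qed.

Lemma W1pZ c v : W1p p Omega v -> W1p p Omega (fun x => c * v x).
Proof.
move=> W1; split; first by apply: in_LpZ; case: W1.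
by exists (fun x => c *: grad p Omega v x); apply: weak_gradientZ; [case: W1|exact: gradP].
Qed.

Lemma grad_energyZ c v : W1p p Omega v ->
  grad_energy p Omega (fun x => c * v x) = ((`|c| `^ p)%:E * grad_energy p Omega v)%E.
Proof.
move=> W1; rewrite /grad_energy.
transitivity (\int[leb]_(x in Omega) (enorm (c *: grad p Omega v x) `^ p)%:E)%E.
  apply: integral_enorm_ae.
  - by move=> i; exact: (measurable_grad i (W1pZ c W1)).
  - move=> i; under eq_fun do rewrite mxE.
    by apply: measurable_funM => //; exact: measurable_grad.
  - exact: ae_gradZ.
under eq_integral do rewrite enormZ powRM ?enorm_ge0 // EFinM.
rewrite ge0_integralZl_EFin ?powR_ge0 //.
  by move=> x _; rewrite lee_fin powR_ge0.
apply/measurable_EFinP/measurable_fun_powR/measurable_enorm => i.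
exact: measurable_grad.
Qed.

Lemma W01pZ c v : W01p p Omega v -> W01p p Omega (fun x => c * v x).
Proof.
move=> [W1 [phi_ [tphi cv cg]]]; split; first exact: W1pZ.
have [[mv _] _] := W1.
have cfin : (`|c| `^ p)%:E \is a fin_num by [].
exists (fun k x => c * phi_ k x); split.
- by move=> k; exact: test_functionZ.
- rewrite (_ : (fun k => _) = (fun k => (`|c| `^ p)%:E *
    \int[leb]_(x in Omega) (`|phi_ k x - v x| `^ p)%:E)%E).
    by have := cvgeZl cfin cv; rewrite mule0; exact.
  apply/funext => k.
  under eq_integral do rewrite -mulrBr normrM powRM // EFinM.
  rewrite ge0_integralZl_EFin ?powR_ge0 //.
  apply/measurable_EFinP/measurable_fun_powR/measurableT_comp => //.
    by apply: measurable_funB => //; exact: test_function_measurable (tphi k).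
- rewrite (_ : (fun k => _) = (fun k => (`|c| `^ p)%:E *
    \int[leb]_(x in Omega) (enorm (cgrad (phi_ k) x - grad p Omega v x) `^ p)%:E)%E).
    by have := cvgeZl cfin cg; rewrite mule0; exact.
  apply/funext => k.
  have md i : measurable_fun Omega (fun x => (cgrad (phi_ k) x - grad p Omega v x) ord0 i).
    under eq_fun do rewrite !mxE.
    apply: measurable_funB; last exact: measurable_grad.
    exact: test_function_measurable (test_function_pderiv i (tphi k)).
  transitivity (\int[leb]_(x in Omega)
      (enorm (c *: (cgrad (phi_ k) x - grad p Omega v x)) `^ p)%:E)%E.
    apply: integral_enorm_ae.
    + move=> i; under eq_fun do rewrite !mxE.
      apply: measurable_funB; last exact: (measurable_grad i (W1pZ c W1)).
      exact: test_function_measurable (test_function_pderiv i (test_functionZ c (tphi k))).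
    + by move=> i; under eq_fun do rewrite mxE; exact: measurable_funM.
    + apply: filterS (ae_gradZ c W1) => x gx Ox.
      by rewrite gx // (cgradZ _ _ (tphi k)) scalerBr.
  under eq_integral do rewrite enormZ powRM ?enorm_ge0 // EFinM.
  rewrite ge0_integralZl_EFin ?powR_ge0 //.
    by move=> x _; rewrite lee_fin powR_ge0.
  exact/measurable_EFinP/measurable_fun_powR/measurable_enorm.
Qed.

End sobolev_spaces.

(** * Tools for the basic inequality: a smooth modulus and Young inequalities *)

Section smooth_modulus.
Context {R : realType} {n : nat}.
Variable Omega : set 'rV[R]_n.

(** A smooth substitute for $|\phi|$; the constant is subtracted to keep the
    support of $\phi$. *)
Definition smooth_abs (e : R) (phi : 'rV[R]_n -> R) (x : 'rV[R]_n) : R :=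
  Num.sqrt (phi x * phi x + e * e) + - e.

Lemma smooth_abs_ge0 e phi x : 0 < e -> 0 <= smooth_abs e phi x.
Proof.
move=> e0; rewrite subr_ge0 -[leLHS](gtr0_norm e0) -sqrtr_sqr.
by apply: ler_wsqrtr; rewrite expr2 lerDr -expr2 sqr_ge0.
Qed.

Lemma abs_le_smooth_abs e phi x : 0 < e -> `|phi x| <= smooth_abs e phi x + e.
Proof.
move=> e0; rewrite subrK -sqrtr_sqr; apply: ler_wsqrtr.
by rewrite expr2 lerDl -expr2 sqr_ge0.
Qed.

Lemma test_function_smooth_abs e phi : 0 < e -> test_function Omega phi ->
  test_function Omega (smooth_abs e phi).
Proof.
move=> e0 [sphi [K [cK KO K0]]]; split.
  move=> k; apply: CkD; last exact: Ck_cst.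
  apply: Ck_sqrt; first by move=> x; rewrite ltr_wpDl ?mulr_gt0 // -expr2 sqr_ge0.
  by apply: CkD; [apply: CkM|exact: Ck_cst].
exists K; split => // x Kx.
by rewrite /smooth_abs K0 // mul0r add0r -expr2 sqrtr_sqr gtr0_norm // subrr.
Qed.

(** The gradient of $\sqrt{\phi^2+e^2}$ is that of $\phi$ multiplied by
    $\phi/\sqrt{\phi^2+e^2}$. *)
Lemma enorm_cgrad_smooth_abs e phi x : 0 < e -> Ck 1 phi ->
  enorm (cgrad (smooth_abs e phi) x) <= enorm (cgrad phi x).
Proof.
move=> e0 cphi.
pose c := phi x / Num.sqrt (phi x * phi x + e * e).
have f0 : 0 < phi x * phi x + e * e by rewrite ltr_wpDl ?mulr_gt0 // -expr2 sqr_ge0.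
have -> : cgrad (smooth_abs e phi) x = c *: cgrad phi x.
  apply/rowP => i; rewrite !mxE /pderiv.
  have d1 := Ck_is_derive i x cphi.
  have d2 : is_derive x (delta_mx ord0 i) (fun y => phi y * phi y + e * e)
     (phi x * pderiv phi i x + phi x * pderiv phi i x + 0).
    exact: (is_deriveD (is_deriveM d1 d1) (is_derive_cst _ _ _)).
  have d3 := @is_derive_comp1 _ _ _ (fun y => phi y * phi y + e * e) _ _ _ _ (is_derive1_sqrt f0) d2.
  have d4 := is_deriveD d3 (is_derive_cst (- e) _ _).
  rewrite [LHS](derive_val (is_derive := d4)) /c /pderiv addr0.
  have s0 : Num.sqrt (phi x * phi x + e * e) != 0 by rewrite gt_eqF // sqrtr_gt0.
  by field.
rewrite enormZ ler_piMl ?enorm_ge0 // /c normrM normfV [X in _ / X]ger0_norm ?sqrtr_ge0 //.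
rewrite ler_pdivrMr ?sqrtr_gt0 // mul1r -sqrtr_sqr; apply: ler_wsqrtr.
by rewrite expr2 lerDl -expr2 sqr_ge0.
Qed.

End smooth_modulus.

Section young.
Context {R : realType}.
Variable p : R.
Hypothesis p1 : 1 < p.

Let p0 : 0 < p. Proof. exact: lt_trans p1. Qed.

Lemma young_powR (a b : R) : 0 <= a -> 0 <= b ->
  a `^ (p - 1) * b <= (p - 1) / p * a `^ p + p^-1 * b `^ p.
Proof.
move=> a0 b0.
have pm : 0 < p - 1 by rewrite subr_gt0.
have q0 : 0 < p / (p - 1) by rewrite divr_gt0.
have := conjugate_powR (powR_ge0 a (p - 1)) b0 q0 p0.
rewrite -powRrM mulrCA divff ?gt_eqF // mulr1 invf_div => /(_ _).
rewrite [a `^ p * _]mulrC [b `^ p / p]mulrC; apply.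
by field; rewrite gt_eqF.
Qed.

(** Applied to $a$ and $b/s$: the coefficient of $a^p$ can be made small. *)
Lemma young_powR_scaled (s a b : R) : 0 < s -> 0 <= a -> 0 <= b ->
  a `^ (p - 1) * b <= s * ((p - 1) / p) * a `^ p + s * s `^ (- p) / p * b `^ p.
Proof.
move=> s0 a0 b0.
have := young_powR a0 (divr_ge0 b0 (ltW s0)).
rewrite powRM ?invr_ge0 ?(ltW s0) // -[s^-1]powR_inv1 ?(ltW s0) // -powRrM mulN1r.
rewrite powR_inv1 ?(ltW s0) // => /(ler_wpM2l (ltW s0)).
have -> : s * (a `^ (p - 1) * (b / s)) = a `^ (p - 1) * b.
  by field; rewrite gt_eqF.
move=> /le_trans; apply; rewrite le_eqVlt; apply/orP; left; apply/eqP.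
by field; rewrite gt_eqF.
Qed.

(** Either $t \le s$, or $t/s \le (t/s)^p$. Integrated over a set of finite
    measure, this is how convergence in $L^p$ yields convergence in $L^1$. *)
Lemma le_affine_powR (s t : R) : 0 < s -> 0 <= t -> t <= s + s * s `^ (- p) * t `^ p.
Proof.
move=> s0 t0; have [ts|st] := leP t s.
  by rewrite (le_trans ts) // lerDl !mulr_ge0 ?powR_ge0 // ltW.
have t1 : 1 <= t / s by rewrite ler_pdivlMr // mul1r ltW.
have := le1r_powR t1 (ltW p1).
have sp : s^-1 `^ p = s `^ (- p) by rewrite -powR_inv1 ?(ltW s0) // -powRrM mulN1r.
rewrite powRM ?invr_ge0 ?(ltW s0) // sp ler_pdivrMr // => /le_trans; apply.
rewrite [leLHS](_ : _ = s * s `^ (- p) * t `^ p); last by ring.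
by rewrite lerDr ltW.
Qed.

(** The integrand of the weak equation, for a test function whose gradient $y$
    is controlled by a limit $z$ and an error $w$. *)
Lemma dotrV_young n (s : R) (x y z w : 'rV[R]_n) : 0 < s ->
  enorm y <= enorm z + enorm w ->
  `|enorm x `^ (p - 2) * dotrV x y| <=
  (1 + s) * ((p - 1) / p) * enorm x `^ p + p^-1 * enorm z `^ p +
  s * s `^ (- p) / p * enorm w `^ p.
Proof.
move=> s0 yzw.
apply: (@le_trans _ _ (enorm x `^ (p - 1) * (enorm z + enorm w))).
  rewrite normrM (ger0_norm (powR_ge0 _ _)).
  apply: le_trans (ler_wpM2l (powR_ge0 _ _) (dotrV_abs_le x y)) _.
  have [x0|x0] := eqVneq (enorm x) 0.
    by rewrite x0 mul0r mulr0 mulr_ge0 ?powR_ge0 // addr_ge0 ?enorm_ge0.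
  rewrite mulrA -{2}[enorm x]powRr1 ?enorm_ge0 // -powRD; last by rewrite x0 implybT.
  rewrite (_ : p - 2 + 1 = p - 1); last by ring.
  by rewrite ler_wpM2l ?powR_ge0.
rewrite mulrDr.
apply: le_trans (lerD (young_powR (enorm_ge0 x) (enorm_ge0 z))
  (young_powR_scaled s0 (enorm_ge0 x) (enorm_ge0 w))) _.
by rewrite le_eqVlt; apply/orP; left; apply/eqP; ring.
Qed.

End young.

(** * The basic inequality for weak solutions *)

Section weak_solutions.
Context {R : realType} {n : nat}.
Variable p : R.
Hypothesis p1 : 1 < p.
Variable Omega : set 'rV[R]_n.
Hypothesis oO : open Omega.
Hypothesis bO : bounded_set Omega.
Variables (lam : R) (u : 'rV[R]_n -> R).
Hypothesis hu : weak_solution p Omega lam u.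
Local Notation leb := (lebesgue_rV R n).

Let mO : measurable Omega. Proof. exact: open_rV_measurable. Qed.
Let p0 : p != 0. Proof. by rewrite gt_eqF // (lt_trans ltr01). Qed.
Let W1u : W1p p Omega u. Proof. by case: hu => -[]. Qed.
Let mu : measurable_fun Omega u. Proof. by case: W1u => -[]. Qed.

(** The essential infimum is positive on each closed box inside $\Omega$. *)
Lemma weak_solution_gt0 : {ae leb, forall x, Omega x -> 0 < u x}.
Proof.
have [_ uK _] := hu; apply: ae_open_obox => // a b abO.
have := uK _ (@compact_cbox _ _ a b) abO; rewrite /ess_inf_on => K0.
apply: filterS (ess_inf_le leb (patch (cst +oo%E) (cbox a b) (EFin \o u))) => x ux xab.
have xc : cbox a b x by move=> i; have /andP[/ltW -> /ltW ->] := xab i.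
by have := lt_le_trans K0 ux; rewrite /patch mem_set.
Qed.

(** Equal to $1/u$ wherever $u$ is positive, and nonnegative and measurable
    everywhere. *)
Definition recip (x : 'rV[R]_n) : R := u x `^ (-1).

Lemma recip_ge0 x : 0 <= recip x. Proof. exact: powR_ge0. Qed.

Lemma recipE x : 0 < u x -> recip x = (u x)^-1.
Proof. by move=> u0; rewrite /recip powR_inv1 // ltW. Qed.

Lemma measurable_recip : measurable_fun Omega recip.
Proof. exact: measurable_fun_powR. Qed.

Lemma measurable_invr : measurable_fun Omega (fun x => (u x)^-1).
Proof.
have -> : (fun x => (u x)^-1) = (fun x => u x * `|u x| `^ (- 2%:R)).
  (* $1/u = u |u|^{-2}$, also where $u$ vanishes since $1/0 = 0$ *)
  apply/funext => x; rewrite powR_invn // -normrX [X in _ / X]ger0_norm ?sqr_ge0 //.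
  by have [->|u0] := eqVneq (u x) 0; [rewrite invr0 mul0r|field].
by apply: measurable_funM => //; apply: measurable_fun_powR; exact: measurableT_comp.
Qed.

Lemma integral_recip phi : measurable_fun Omega phi ->
  (\int[leb]_(x in Omega) ((u x)^-1 * phi x)%:E =
   \int[leb]_(x in Omega) (recip x * phi x)%:E)%E.
Proof.
move=> mphi; apply: ae_eq_integral => //.
- by apply/measurable_EFinP/measurable_funM => //; exact: measurable_invr.
- by apply/measurable_EFinP/measurable_funM => //; exact: measurable_recip.
- by apply: filterS weak_solution_gt0 => x ux Ox; rewrite recipE // ux.
Qed.

(** Testing the equation with the solution itself. *)
Lemma weak_solution_energy : grad_energy p Omega u = (lam%:E * leb Omega)%E.
Proof.
have [W01u _ /(_ u W01u) E] := hu.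
transitivity (\int[leb]_(x in Omega) (enorm (grad p Omega u x) `^ (p - 2) *
    dotrV (grad p Omega u x) (grad p Omega u x))%:E)%E.
  apply: eq_integral => x _; congr (_%:E); rewrite -enorm_sqr.
  have [->|x0] := eqVneq (enorm (grad p Omega u x)) 0.
    by rewrite powR0 // expr0n mulr0.
  rewrite -[in _ ^+ 2]powR_mulrn ?enorm_ge0 // -powRD ?x0 ?implybT //.
  by congr powR; ring.
rewrite E integral_recip //; congr (_ * _)%E.
transitivity (\int[leb]_(x in Omega) (cst 1%E) x)%E; last by rewrite integral_cst // mul1e.
apply: ae_eq_integral => //.
- by apply/measurable_EFinP/measurable_funM => //; exact: measurable_recip.
- apply: filterS weak_solution_gt0 => x ux Ox.
  by rewrite recipE ?ux //= mulVf // gt_eqF // ux.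
Qed.

Hypothesis lam0 : 0 <= lam.
Let E0 : R := lam * fine (leb Omega).

Let lebO : leb Omega = (fine (leb Omega))%:E.
Proof. by rewrite fineK // ge0_fin_numE //; exact: bounded_open_lty. Qed.

Let energyE : grad_energy p Omega u = E0%:E.
Proof. by rewrite weak_solution_energy lebO. Qed.

Let mgu : measurable_fun Omega (fun x => enorm (grad p Omega u x)).
Proof. by apply: measurable_enorm => i; exact: measurable_grad. Qed.

(** The weak equation tested with a smooth function whose gradient is bounded
    by that of an approximant $\phi$ of $v$, after Young's inequality; the
    parameter $s$ absorbs the distance from $\nabla\phi$ to $\nabla v$. *)
Lemma weak_solution_test_le (s : R) v phi psi : 0 < s -> W1p p Omega v ->
  test_function Omega phi -> test_function Omega psi ->
  (forall x, enorm (cgrad psi x) <= enorm (cgrad phi x)) ->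
  (lam%:E * \int[leb]_(x in Omega) (recip x * psi x)%:E <=
   ((1 + s) * ((p - 1) / p) * E0)%:E + p^-1%:E * grad_energy p Omega v +
   (s * s `^ (- p) / p)%:E * \int[leb]_(x in Omega)
      (enorm (cgrad phi x - grad p Omega v x) `^ p)%:E)%E.
Proof.
move=> s0 W1v tphi tpsi psiphi.
have pgt0 : 0 < p by rewrite (lt_trans ltr01).
have mpsi : measurable_fun Omega psi by exact: test_function_measurable tpsi.
have [_ _ /(_ _ (W01p_test_function p1 oO bO tpsi)) E] := hu.
rewrite -integral_recip // -E.
have mgv i := measurable_grad i W1v.
have mgpsi i := measurable_grad i (proj1 (W01p_test_function p1 oO bO tpsi)).
have mF : measurable_fun Omega (fun x => enorm (grad p Omega u x) `^ (p - 2) *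
    dotrV (grad p Omega u x) (grad p Omega psi x)).
  apply: measurable_funM; first exact: measurable_fun_powR.
  by apply: measurable_dotrV => // i; exact: measurable_grad.
have mEF := (measurable_EFinP Omega _).2 mF.
apply: le_trans (lee_abs _) _.
apply: le_trans (le_abse_integral leb mO mEF) _.
have md : measurable_fun Omega (fun x => enorm (cgrad phi x - grad p Omega v x)).
  apply: measurable_enorm => i; under eq_fun do rewrite !mxE.
  by apply: measurable_funB => //; exact: test_function_measurable (test_function_pderiv i tphi).
have mev : measurable_fun Omega (fun x => enorm (grad p Omega v x)) by exact: measurable_enorm.
pose c1 := (1 + s) * ((p - 1) / p); pose c2 := p^-1; pose c3 := s * s `^ (- p) / p.
have c10 : 0 <= c1.
  by apply: mulr_ge0; [rewrite addr_ge0 // ltW|apply: divr_ge0; rewrite ?subr_ge0 ltW].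
have c20 : 0 <= c2 by rewrite invr_ge0 ltW.
have c30 : 0 <= c3 by rewrite !mulr_ge0 ?powR_ge0 ?invr_ge0 // ltW.
apply: (@le_trans _ _ (\int[leb]_(x in Omega)
   ((c1%:E * (enorm (grad p Omega u x) `^ p)%:E + c2%:E * (enorm (grad p Omega v x) `^ p)%:E) +
     c3%:E * (enorm (cgrad phi x - grad p Omega v x) `^ p)%:E))%E).
  apply: ae_ge0_le_integral => //.
  - exact: measurableT_comp.
  - by move=> x _; rewrite -!EFinM -!EFinD lee_fin; apply: addr_ge0; [apply: addr_ge0|]; apply: mulr_ge0 => //; exact: powR_ge0.
  - by apply/measurable_EFinP; apply: measurable_funD; [apply: measurable_funD|];
      apply: measurable_funM => //; exact: measurable_fun_powR.
  - have wg := weak_gradient_test_function p1 oO bO tpsi.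
    apply: filterS (ae_grad p1 oO bO wg) => x gx Ox.
    rewrite -!EFinM -!EFinD lee_fin; apply: dotrV_young => //.
    rewrite gx // (le_trans (psiphi x)) //.
    by rewrite -{1}(subrK (grad p Omega v x) (cgrad phi x)) addrC enormD.
have ms (c : R) (f : 'rV[R]_n -> R) : measurable_fun Omega f ->
    measurable_fun Omega (fun x => (c%:E * (f x `^ p)%:E)%E).
  by move=> mf; apply/measurable_EFinP/measurable_funM => //; exact: measurable_fun_powR.
rewrite ge0_integralD //; last 4 first.
- by move=> x _; rewrite -!EFinM -!EFinD lee_fin; apply: addr_ge0; apply: mulr_ge0 => //; exact: powR_ge0.
- by apply: emeasurable_funD; exact: ms.
- by move=> x _; rewrite -!EFinM lee_fin mulr_ge0 ?powR_ge0.
- exact: ms.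
rewrite ge0_integralD //; last 4 first.
- by move=> x _; rewrite -!EFinM lee_fin mulr_ge0 ?powR_ge0.
- exact: ms.
- by move=> x _; rewrite -!EFinM lee_fin mulr_ge0 ?powR_ge0.
- exact: ms.
have Z (c : R) (f : 'rV[R]_n -> R) : 0 <= c -> measurable_fun Omega f ->
    (\int[leb]_(x in Omega) (c%:E * (f x `^ p)%:E) =
     c%:E * \int[leb]_(x in Omega) (f x `^ p)%:E)%E.
  move=> c0 mf; rewrite ge0_integralZl_EFin //.
    by move=> x _; rewrite lee_fin powR_ge0.
  by apply/measurable_EFinP; exact: measurable_fun_powR.
have Eu : (\int[leb]_(x in Omega) (enorm (grad p Omega u x) `^ p)%:E = E0%:E)%E.
  exact: energyE.
have I1 := Z c1 _ c10 mgu; have I2 := Z c2 _ c20 mev; have I3 := Z c3 _ c30 md.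
rewrite Eu -EFinM in I1.
apply: leeD; [apply: leeD|].
- by rewrite I1.
- by rewrite I2.
- by rewrite I3.
Qed.

(** Truncating $1/u$ makes its product with an error that is small in $L^1$
    small in $L^1$. *)
Let recip_trunc (m : nat) x := Num.min (recip x) m%:R.

Let recip_trunc_ge0 m x : 0 <= recip_trunc m x.
Proof. by rewrite le_min recip_ge0 ler0n. Qed.

Let measurable_recip_trunc m : measurable_fun Omega (recip_trunc m).
Proof. by apply: measurable_minr => //; exact: measurable_recip. Qed.

Let recip_trunc_le m (s e a b c : R) x : 0 < s -> 0 < e -> 0 <= b -> `|a| <= b + e ->
  recip_trunc m x * `|c| <=
  recip x * b + m%:R * (s * s `^ (- p)) * `|a - c| `^ p + m%:R * (s + e).
Proof.
move=> s0 e0 b0 ab.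
have h1 : `|c| <= b + (s * s `^ (- p) * `|a - c| `^ p + (s + e)).
  have h := le_affine_powR p1 s0 (normr_ge0 (a - c)).
  have : `|c| <= `|a| + `|a - c| by rewrite -[X in `|X| <= _](subKr a c); exact: ler_normB.
  by move: h ab; lra.
apply: le_trans (ler_wpM2l (recip_trunc_ge0 m x) h1) _.
rewrite mulrDr -addrA; apply: lerD; first by rewrite ler_wpM2r // ge_min lexx.
rewrite [leRHS](_ : _ = m%:R * (s * s `^ (- p) * `|a - c| `^ p + (s + e))); last by ring.
rewrite ler_wpM2r //; last by rewrite ge_min lexx orbT.
by rewrite addr_ge0 ?mulr_ge0 ?powR_ge0 ?addr_ge0 // ltW.
Qed.

(** The limit along test functions converging to $v$, with $s$ and the
    truncation level fixed; the smooth modulus of the $k$-th one is taken with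
    $e = 1/(k+1)$. *)
Let trunc_bound (m : nat) (s : R) v : 0 < s -> W01p p Omega v ->
  (lam%:E * \int[leb]_(x in Omega) (recip_trunc m x * `|v x|)%:E <=
   ((1 + s) * ((p - 1) / p) * E0)%:E + p^-1%:E * grad_energy p Omega v +
   (lam * (m%:R * s * fine (leb Omega)))%:E)%E.
Proof.
move=> s0 [W1v [phi_ [tphi cv cg]]]; have [[mv _] _] := W1v.
pose A := (((1 + s) * ((p - 1) / p) * E0)%:E + p^-1%:E * grad_energy p Omega v +
   (lam * (m%:R * s * fine (leb Omega)))%:E)%E.
pose c3 := s * s `^ (- p) / p.
pose c4 := lam * (m%:R * (s * s `^ (- p))).
pose c5 := lam * (m%:R * fine (leb Omega)).
pose dk k := (\int[leb]_(x in Omega) (enorm (cgrad (phi_ k) x - grad p Omega v x) `^ p)%:E)%E.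
pose ek k := (\int[leb]_(x in Omega) (`|phi_ k x - v x| `^ p)%:E)%E.
have cvgA : (A + (c3%:E * dk k + c4%:E * ek k + c5%:E * (k.+1%:R^-1)%:E))%E @[k --> \oo] --> A.
  have c0 (c : R) (f : nat -> \bar R) : f k @[k --> \oo] --> 0%E ->
     (c%:E * f k)%E @[k --> \oo] --> 0%E.
    by move=> cf; have := cvgeZl (y := c%:E) isT cf; rewrite mule0; exact.
  have z0 : ((0 : \bar R) +? 0)%E by [].
  have nf : Filter \oo by typeclasses eauto.
  have H1 := cvgeD z0 (c0 c3 _ cg) (c0 c4 _ cv); rewrite adde0 in H1.
  have {}H1 := H1 nf.
  have H := cvgeD z0 H1 (c0 c5 _ cvge_harmonic); rewrite adde0 in H.
  have {}H := H nf.
  have ad : (A +? 0)%E by rewrite fin_num_adde_defl.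
  by have := cvgeD ad (cvg_cst A) H; rewrite adde0; exact.
apply: cvge_ge cvgA; apply: nearW => k.
pose e : R := k.+1%:R^-1.
have e0 : 0 < e by rewrite invr_gt0.
pose psi := smooth_abs e (phi_ k).
have tpsi : test_function Omega psi by exact: test_function_smooth_abs.
have psi0 x : 0 <= psi x by exact: smooth_abs_ge0.
have mpsi : measurable_fun Omega psi by exact: test_function_measurable tpsi.
have mphi : measurable_fun Omega (phi_ k) by exact: test_function_measurable (tphi k).
have [sphi _] := tphi k.
have test := weak_solution_test_le s0 W1v (tphi k) tpsi
  (fun x => enorm_cgrad_smooth_abs x e0 (sphi 1%N)).
have s0' := ltW s0; have e0' := ltW e0.
have le1 : (\int[leb]_(x in Omega) (recip_trunc m x * `|v x|)%:E <=
   \int[leb]_(x in Omega) (recip x * psi x)%:E +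
   (m%:R * (s * s `^ (- p)))%:E * ek k + (m%:R * (s + e) * fine (leb Omega))%:E)%E.
  have mc : (0 : R) <= m%:R * (s * s `^ (- p)) by rewrite !mulr_ge0 ?powR_ge0.
  have m1 : measurable_fun Omega (fun x => (recip x * psi x)%:E).
    by apply/measurable_EFinP/measurable_funM => //; exact: measurable_recip.
  have m2 : measurable_fun Omega (fun x => (`|phi_ k x - v x| `^ p)%:E).
    by apply/measurable_EFinP/measurable_fun_powR/measurableT_comp => //; exact: measurable_funB.
  apply: (@le_trans _ _ (\int[leb]_(x in Omega) ((recip x * psi x)%:E +
     (m%:R * (s * s `^ (- p)))%:E * (`|phi_ k x - v x| `^ p)%:E + (m%:R * (s + e))%:E))%E).
    apply: ge0_le_integral => //.
    - by move=> x _; rewrite lee_fin mulr_ge0.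
    - by apply/measurable_EFinP/measurable_funM => //; exact: measurableT_comp.
    - apply: emeasurable_funD => //; apply: emeasurable_funD => //.
      exact: measurable_funeM.
    - move=> x _; rewrite -EFinM -!EFinD lee_fin; apply: recip_trunc_le => //.
      exact: abs_le_smooth_abs.
  rewrite ge0_integralD //; last 3 first.
  - by move=> x _; rewrite -EFinM -EFinD lee_fin addr_ge0 // mulr_ge0 ?recip_ge0 ?powR_ge0.
  - by apply: emeasurable_funD => //; exact: measurable_funeM.
  - by move=> x _; rewrite lee_fin mulr_ge0 ?addr_ge0.
  rewrite ge0_integralD //; last 3 first.
  - by move=> x _; rewrite lee_fin mulr_ge0 ?recip_ge0.
  - by move=> x _; rewrite -EFinM lee_fin mulr_ge0 ?powR_ge0.
  - exact: measurable_funeM.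
  rewrite ge0_integralZl_EFin //.
  apply: leeD => //; rewrite le_eqVlt; apply/orP; left; apply/eqP.
  transitivity ((m%:R * (s + e))%:E * leb Omega)%E; first exact: integral_cst.
  by rewrite [in LHS]lebO -EFinM.
apply: le_trans (lee_wpmul2l _ le1) _; first by rewrite lee_fin.
have dk0 : (0 <= dk k)%E by apply: integral_ge0 => x _; rewrite lee_fin powR_ge0.
have ek0 : (0 <= ek k)%E by apply: integral_ge0 => x _; rewrite lee_fin powR_ge0.
have I0 : (0 <= \int[leb]_(x in Omega) (recip x * psi x)%:E)%E.
  by apply: integral_ge0 => x _; rewrite lee_fin mulr_ge0 ?recip_ge0.
have mc : (0 : R) <= m%:R * (s * s `^ (- p)) by rewrite !mulr_ge0 ?powR_ge0.
have K0 : (0 : R) <= m%:R * (s + e) * fine (leb Omega).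
  by rewrite !mulr_ge0 ?addr_ge0 // fine_ge0.
rewrite ge0_muleDr; last 2 first.
- by rewrite adde_ge0 // mule_ge0 // lee_fin.
- by rewrite lee_fin.
rewrite ge0_muleDr //; last by rewrite mule_ge0 // lee_fin.
rewrite muleA -!EFinM.
rewrite /A addeACA [X in (_ <= X + _)%E]addeA; apply: leeD; [apply: leeD|].
- exact: test.
- by rewrite /c4 lexx.
- by rewrite -!EFinD lee_fin /c5 -/e le_eqVlt; apply/orP; left; apply/eqP; ring.
Qed.

(** For $v \ge 0$ this is the convexity of the $p$-energy: its tangent inequality
    at $u$, whose linear part is computed by the weak equation. The modulus of
    $v$ is reached through smooth moduli of test functions, and the parameters
    $s$ and $m$ are then removed, in this order. *)
Lemma weak_solution_ineq v : W01p p Omega v ->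
  (lam%:E * \int[leb]_(x in Omega) (recip x * `|v x|)%:E <=
   ((p - 1) / p * (lam * fine (leb Omega)))%:E + p^-1%:E * grad_energy p Omega v)%E.
Proof.
move=> W01v; have [[[mv _] _] _] := W01v.
have pgt0 : 0 < p by rewrite (lt_trans ltr01).
have V0 : 0 <= fine (leb Omega) by rewrite fine_ge0.
have bm m : (lam%:E * \int[leb]_(x in Omega) (recip_trunc m x * `|v x|)%:E <=
   ((p - 1) / p * E0)%:E + p^-1%:E * grad_energy p Omega v)%E.
  apply/lee_addgt0Pr => e e0.
  (* $K$ is the coefficient of $s$ in the bound with parameter $s$ *)
  pose K := (p - 1) / p * E0 + lam * (m%:R * fine (leb Omega)).
  have K0 : 0 <= K.
    rewrite addr_ge0 ?mulr_ge0 //; first by rewrite subr_ge0 ltW.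
    by rewrite invr_ge0 ltW.
  have s0 : 0 < e / (K + 1) by rewrite divr_gt0 // ltr_wpDl.
  apply: le_trans (trunc_bound m s0 W01v) _.
  rewrite addeAC -EFinD [leRHS]addeAC -EFinD; apply: leeD => //.
  rewrite lee_fin.
  have -> : (1 + e / (K + 1)) * ((p - 1) / p) * E0 +
      lam * (m%:R * (e / (K + 1)) * fine (leb Omega)) =
      (p - 1) / p * E0 + e * (K / (K + 1)) by rewrite /K; ring.
  rewrite lerD2l; apply: ler_piMr; first exact: ltW.
  by rewrite ler_pdivrMr ?ltr_wpDl // mul1r lerDl.
have cvgI : (\int[leb]_(x in Omega) (recip_trunc m x * `|v x|)%:E)%E @[m --> \oo] -->
    (\int[leb]_(x in Omega) (recip x * `|v x|)%:E)%E.
  have := @cvg_monotone_convergence _ _ _ leb _ mO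
    (fun m x => (recip_trunc m x * `|v x|)%:E).
  rewrite (_ : (\int[leb]_(x in Omega) (fun x => _) x)%E =
     (\int[leb]_(x in Omega) (recip x * `|v x|)%:E)%E); last first.
    apply: eq_integral => x _; apply/cvg_lim => //; apply: cvg_near_cst.
    exists (Num.truncn (recip x)).+1 => // m /= xm.
    congr (_ * _)%:E; apply/min_idPl.
    by rewrite (le_trans (ltW (truncnS_gt _))) // ler_nat.
  apply.
  - by move=> m; apply/measurable_EFinP/measurable_funM => //; exact: measurableT_comp.
  - by move=> m x _; rewrite lee_fin mulr_ge0.
  - move=> x _ m1 m2 m12; rewrite lee_fin ler_wpM2r //.
    by rewrite /recip_trunc le_min !ge_min lexx /= (ler_nat _ m1 m2) m12 !orbT.
apply: cvge_le (cvgeZl (y := lam%:E) isT cvgI).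
by apply: nearW => m; exact: bm.
Qed.

End weak_solutions.

(** * Difference quotients of exponentials, and vanishing gradients *)

Section exponential_quotients.
Context {R : realType}.
Implicit Types (l q r s : R).

Lemma weighted_amgm q (X Y : R) : 0 < q < 1 -> 0 <= X -> 0 <= Y ->
  X `^ q * Y `^ (1 - q) <= q * X + (1 - q) * Y.
Proof.
move=> /andP[q0 q1] X0 Y0; have q'0 : 0 < 1 - q by rewrite subr_gt0.
have := @conjugate_powR _ _ _ _ _ (powR_ge0 X q) (powR_ge0 Y (1 - q))
  (_ : 0 < q^-1) (_ : 0 < (1 - q)^-1).
rewrite !invr_gt0 !invrK subrKC -!powRrM !divff ?gt_eqF // !powRr1 //.
by rewrite [X * _]mulrC [Y * _]mulrC; apply.
Qed.

(** The difference quotients at $0$ of $r \mapsto e^{rl}$, which decrease to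
    $l$ as $r$ decreases to $0$. *)
Definition expq l r : R := (expR (r * l) - 1) / r.

Lemma expq_ge l r : 0 < r -> l <= expq l r.
Proof.
move=> r0; rewrite /expq ler_pdivlMr // mulrC.
by have := expR_ge1Dx (r * l); lra.
Qed.

(** Convexity of the exponential, as the inequality of weighted means between
    $e^{sl}$ and 1. *)
Lemma expq_mono l r s : 0 < r -> r <= s -> expq l r <= expq l s.
Proof.
move=> r0; rewrite le_eqVlt => /orP[/eqP <- //|rs].
have s0 : 0 < s by rewrite (lt_trans r0).
have q01 : 0 < r / s < 1 by rewrite divr_gt0 // ltr_pdivrMr // mul1r.
have := weighted_amgm q01 (expR_ge0 (s * l)) ler01.
rewrite powR1 !mulr1 [in X in X <= _ -> _]/powR gt_eqF ?expR_gt0 // expRK.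
rewrite (_ : r / s * (s * l) = r * l); last by field; rewrite gt_eqF.
move=> h; rewrite /expq ler_pdivrMr // -mulrA [_^-1 * r]mulrC mulrC.
by move: h; lra.
Qed.

(** Squeezed between $l$ and $l/(1-l/(n+1))$, the latter because
    $e^{rl} \le 1/(1-rl)$. *)
Lemma expq_cvg l : expq l n.+1%:R^-1 @[n --> \oo] --> l.
Proof.
have h0 : (n.+1%:R^-1 * l : R) @[n --> \oo] --> (0 : R).
  by rewrite -(mul0r l); apply: cvgM; [exact: cvg_harmonic|exact: cvg_cst].
have h1 : (l / (1 - n.+1%:R^-1 * l)) @[n --> \oo] --> l.
  rewrite -[X in _ --> X]divr1; apply: cvgM; first exact: cvg_cst.
  apply: cvgV; first exact: oner_neq0.
  by rewrite -[X in _ --> X]subr0; apply: cvgB => //; exact: cvg_cst.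
apply: squeeze_cvgr h1; last exact: cvg_cst.
near=> n.
have r0 : (0 : R) < n.+1%:R^-1 by rewrite invr_gt0.
rewrite expq_ge //=.
have lt1 : n.+1%:R^-1 * l < 1.
  near: n; have := cvgr_lt _ h0; apply; exact: ltr01.
rewrite /expq; set r := _^-1 in r0 lt1 *.
have d0 : 0 < 1 - r * l by rewrite subr_gt0.
have := expR_ge1Dx (- (r * l)); rewrite expRN => h.
have e0 := expR_gt0 (r * l).
have h2 : (1 - r * l) * expR (r * l) <= 1.
  by move: h; rewrite -(ler_pM2r e0) mulVf ?gt_eqF.
rewrite ler_pdivrMr // mulrAC ler_pdivlMr //.
by move: h2; lra.
Unshelve. all: by end_near. Qed.

End exponential_quotients.

Section vanishing_gradient.
Context {R : realType} {n : nat}.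
Variable p : R.
Hypothesis p1 : 1 < p.
Variable Omega : set 'rV[R]_n.
Hypothesis oO : open Omega.
Hypothesis bO : bounded_set Omega.
Local Notation leb := (lebesgue_rV R n).

Let mO : measurable Omega. Proof. exact: open_rV_measurable. Qed.

(** Integration by parts against the coordinate $x_i$, whose derivative is 1. *)
Lemma abs_integral_test_function_le (M : R) (i : 'I_n) phi : 0 <= M ->
  Omega `<=` cbox (fun=> - M) (fun=> M) -> test_function Omega phi ->
  (`|\int[leb]_(x in Omega) (phi x)%:E| <=
   \int[leb]_(x in Omega) (M * enorm (cgrad phi x))%:E)%E.
Proof.
move=> M0 OM tphi.
have := test_function_parts bO i (@Ck_coord R n 1 i) tphi.
have -> : pderiv (fun x : 'rV[R]_n => x ord0 i) i = fun=> 1.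
  by apply/funext => x; rewrite /pderiv (derive_val (is_derive := is_derive_coord i i x)) eqxx.
under [in RHS]eq_integral do rewrite mul1r.
move=> /(congr1 abse); rewrite abseN => <-.
have mx : measurable_fun Omega (fun x : 'rV[R]_n => x ord0 i).
  by apply: measurable_funTS; exact: measurable_rV_coord.
have mdphi : measurable_fun Omega (pderiv phi i).
  exact: test_function_measurable (test_function_pderiv i tphi).
have mF : measurable_fun Omega (fun x => (x ord0 i * pderiv phi i x)%:E).
  by apply/measurable_EFinP; exact: measurable_funM.
apply: le_trans (le_abse_integral leb mO mF) _.
apply: ge0_le_integral => //.
- exact: measurableT_comp.
- apply/measurable_EFinP/measurable_funM => //; apply: measurable_enorm => j.
  exact: (measurable_cgrad j tphi).
- move=> x Ox; rewrite lee_fin normrM; apply: ler_pM => //.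
    by rewrite ler_norml; exact: OM.
  by have := coord_le_enorm (cgrad phi x) i; rewrite mxE.
Qed.

(** A substitute for the Poincare inequality: by
    [abs_integral_test_function_le], the integrals of approximating test
    functions tend to 0. *)
Lemma W01p_grad0_integral0 (i : 'I_n) v : W01p p Omega v ->
  grad_energy p Omega v = 0%E -> (\int[leb]_(x in Omega) (v x)%:E = 0)%E.
Proof.
move=> [W1v [phi_ [tphi cv cg]]] Ev0.
have [Lv _] := W1v; have [mv _] := Lv; have iv := in_Lp_integrable p1 oO bO Lv.
have [M [M0 OM]] := bounded_cbox bO.
have Vfin : leb Omega \is a fin_num.
  by rewrite ge0_fin_numE //; exact: bounded_open_lty.
pose V := fine (leb Omega).
have V0 : 0 <= V by rewrite fine_ge0.
pose dk k := (\int[leb]_(x in Omega) (enorm (cgrad (phi_ k) x - grad p Omega v x) `^ p)%:E)%E.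
pose ek k := (\int[leb]_(x in Omega) (`|phi_ k x - v x| `^ p)%:E)%E.
have powI (s : R) (f : 'rV[R]_n -> R) : 0 < s -> measurable_fun Omega f ->
    (forall x, 0 <= f x) ->
    (\int[leb]_(x in Omega) (f x)%:E <= (s * V)%:E +
      (s * s `^ (- p))%:E * \int[leb]_(x in Omega) (f x `^ p)%:E)%E.
  move=> s0 mf f0.
  have c0 : 0 <= s * s `^ (- p) by rewrite mulr_ge0 ?powR_ge0 // ltW.
  have mfp : measurable_fun Omega (fun x => (f x `^ p)%:E).
    by apply/measurable_EFinP; exact: measurable_fun_powR.
  apply: (@le_trans _ _ (\int[leb]_(x in Omega) (s%:E + (s * s `^ (- p))%:E * (f x `^ p)%:E))%E).
    apply: ge0_le_integral => //.
    - by move=> x _; rewrite lee_fin.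
    - exact/measurable_EFinP.
    - by apply: emeasurable_funD => //; exact: measurable_funeM.
    - by move=> x _; rewrite -EFinM -EFinD lee_fin; exact: le_affine_powR.
  rewrite ge0_integralD //; last 3 first.
  - by move=> x _; rewrite lee_fin ltW.
  - by move=> x _; rewrite -EFinM lee_fin mulr_ge0 ?powR_ge0.
  - exact: measurable_funeM.
  rewrite ge0_integralZl_EFin //; last by move=> x _; rewrite lee_fin powR_ge0.
  rewrite leeD2r //.
  by rewrite (_ : (\int[leb]_(x in Omega) s%:E = s%:E * leb Omega)%E);
    [rewrite EFinM /V fineK|exact: integral_cst].
have bnd (s : R) : 0 < s -> (`|\int[leb]_(x in Omega) (v x)%:E| <=
    ((1 + M * 2) * V)%:E * s%:E)%E.
  move=> s0; pose c := s * s `^ (- p).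
  have cvgA : ((s * V)%:E + M%:E * ((s * V)%:E + (s * V)%:E) +
      (c%:E * ek k + (M * c)%:E * dk k))%E @[k --> \oo] -->
      ((s * V)%:E + M%:E * ((s * V)%:E + (s * V)%:E))%E.
    have z0 : ((0 : \bar R) +? 0)%E by [].
    have nf : Filter \oo by typeclasses eauto.
    have cz (a : R) (f : nat -> \bar R) : f k @[k --> \oo] --> 0%E ->
       (a%:E * f k)%E @[k --> \oo] --> 0%E.
      by move=> cf; have := cvgeZl (y := a%:E) isT cf; rewrite mule0; exact.
    have H := cvgeD z0 (cz c _ cv) (cz (M * c) _ cg); rewrite adde0 in H.
    have {}H := H nf.
    rewrite -[X in _ --> X]adde0; apply: cvgeD H; last exact: cvg_cst.
    by rewrite fin_num_adde_defl.
  rewrite (_ : ((1 + M * 2) * V)%:E * s%:E =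
    (s * V)%:E + M%:E * ((s * V)%:E + (s * V)%:E))%E; last first.
    by rewrite -!EFinM -!EFinD; congr EFin; ring.
  apply: cvge_ge cvgA; apply: nearW => k.
  have iphi := in_Lp_integrable p1 oO bO (in_Lp_test_function p1 oO bO (tphi k)).
  have mphi : measurable_fun Omega (phi_ k) by exact: test_function_measurable (tphi k).
  have mgphi i := @measurable_cgrad _ _ _ _ i Omega (tphi k).
  have mgv j := measurable_grad j W1v.
  have md : measurable_fun Omega (fun x => enorm (cgrad (phi_ k) x - grad p Omega v x)).
    apply: measurable_enorm => j; under eq_fun do rewrite !mxE.
    by apply: measurable_funB => //; exact: test_function_measurable (test_function_pderiv j (tphi k)).
  have mev : measurable_fun Omega (fun x => enorm (grad p Omega v x)) by exact: measurable_enorm.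
  have -> : (\int[leb]_(x in Omega) (v x)%:E = \int[leb]_(x in Omega) (phi_ k x)%:E -
      \int[leb]_(x in Omega) (phi_ k x - v x)%:E)%E.
    rewrite -integralB //; last by have := integrableB mO iphi iv; apply: eq_integrable.
    by apply: eq_integral => x _; rewrite -EFinB; congr EFin; ring.
  apply: le_trans (lee_abs_sub _ _) _.
  have b1 : (`|\int[leb]_(x in Omega) (phi_ k x - v x)%:E| <= (s * V)%:E + c%:E * ek k)%E.
    have mdf : measurable_fun Omega (fun x => phi_ k x - v x) by exact: measurable_funB.
    apply: le_trans (le_abse_integral leb mO _) _; first exact/measurable_EFinP.
    by apply: powI => //; exact: measurableT_comp.
  have b2 : (`|\int[leb]_(x in Omega) (phi_ k x)%:E| <=
     M%:E * ((s * V)%:E + c%:E * dk k + ((s * V)%:E)))%E.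
    apply: le_trans (abs_integral_test_function_le i (ltW M0) OM (tphi k)) _.
    under eq_integral do rewrite EFinM.
    rewrite ge0_integralZl_EFin ?(ltW M0) //; last 2 first.
    - by move=> x _; rewrite lee_fin enorm_ge0.
    - by apply/measurable_EFinP; exact: measurable_enorm.
    rewrite lee_pmul2l //.
    have h1 := powI _ _ s0 md (fun x => enorm_ge0 _).
    have h2 := powI _ _ s0 mev (fun x => enorm_ge0 _).
    have E0 : (\int[leb]_(x in Omega) (enorm (grad p Omega v x) `^ p)%:E = 0)%E by exact: Ev0.
    rewrite E0 mule0 adde0 in h2.
    apply: le_trans (leeD h1 h2); rewrite -ge0_integralD //; last 4 first.
    - by move=> x _; rewrite lee_fin enorm_ge0.
    - exact/measurable_EFinP.
    - by move=> x _; rewrite lee_fin enorm_ge0.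
    - exact/measurable_EFinP.
    apply: ge0_le_integral => //.
    - by move=> x _; rewrite lee_fin enorm_ge0.
    - by apply/measurable_EFinP; exact: measurable_enorm.
    - by apply: emeasurable_funD; exact/measurable_EFinP.
    - move=> x _; rewrite -EFinD lee_fin.
      by rewrite -{1}(subrK (grad p Omega v x) (cgrad (phi_ k) x)) enormD.
  apply: le_trans (leeD b2 b1) _.
  have dk0 : (0 <= dk k)%E by apply: integral_ge0 => x _; rewrite lee_fin powR_ge0.
  have c0 : 0 <= c by rewrite mulr_ge0 ?powR_ge0 // ltW.
  rewrite addeAC ge0_muleDr; last 2 first.
  - by rewrite -EFinD lee_fin !addr_ge0 // mulr_ge0 // ltW.
  - by rewrite mule_ge0.
  rewrite muleA -EFinM [leLHS]addeC addeACA.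
  by rewrite le_eqVlt eqxx.
have : (`|\int[leb]_(x in Omega) (v x)%:E| <= 0)%E.
  apply/lee_addgt0Pr => e e0; rewrite add0e.
  pose K := (1 + M * 2) * V.
  have K0 : 0 <= K by rewrite mulr_ge0 // addr_ge0 // mulr_ge0 // ltW.
  have s0 : 0 < e / (K + 1) by rewrite divr_gt0 // ltr_wpDl.
  apply: le_trans (bnd _ s0) _; rewrite -EFinM lee_fin -/K mulrCA.
  by apply: ler_piMr; [exact: ltW|rewrite ler_pdivrMr ?ltr_wpDl // mul1r lerDl].
by move=> h; apply/eqP; rewrite -abse_eq0 eq_le h abse_ge0.
Qed.

End vanishing_gradient.

(** * The geometric mean of the solution, and minimality *)

Lemma measurable_lne_EFin {R : realType} :
  measurable_fun [set: R] (fun t : R => lne t%:E).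
Proof.
apply: measurable_fun_ifT => //.
- exact: measurable_fun_ler.
- by apply/measurable_EFinP; exact: measurable_ln.
Qed.

Section real_integrals.
Context d (T : measurableType d) (R : realType).
Variables (m : {measure set T -> \bar R}) (D : set T).
Hypothesis mD : measurable D.
Implicit Types f g : T -> R.

Lemma integrableD_EFin f g : m.-integrable D (EFin \o f) ->
  m.-integrable D (EFin \o g) -> m.-integrable D (EFin \o (fun x => f x + g x)).
Proof. by move=> fi gi; have := integrableD mD fi gi; apply: eq_integrable. Qed.

Lemma integrableZ_EFin (c : R) f : m.-integrable D (EFin \o f) ->
  m.-integrable D (EFin \o (fun x => c * f x)).
Proof. by move=> fi; have := integrableZl mD c fi; apply: eq_integrable. Qed.

Lemma integrable_cst_EFin (c : R) : (m D < +oo)%E ->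
  m.-integrable D (EFin \o (fun=> c)).
Proof.
move=> Dfin; apply/integrableP; split; first exact: measurable_cst.
rewrite (_ : (\int[m]_(x in D) _)%E = (`|c|%:E * m D)%E); last exact: integral_cst.
exact: lte_mul_pinfty.
Qed.

Lemma le_integrable_EFin f g : measurable_fun D f ->
  (forall x, D x -> `|f x| <= g x) -> m.-integrable D (EFin \o g) ->
  m.-integrable D (EFin \o f).
Proof.
move=> mf fg; apply: le_integrable => //; first exact/measurable_EFinP.
by move=> x Dx; rewrite /= lee_fin (le_trans (fg x Dx)) // ler_norm.
Qed.

(** Positive and negative parts are compared separately; no integrability is
    involved, so that the values $\pm\infty$ of the logarithm are harmless. *)
Lemma measurable_le_integral (f g : T -> \bar R) : measurable_fun D f ->
  measurable_fun D g -> (forall x, D x -> f x <= g x)%E ->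
  (\int[m]_(x in D) f x <= \int[m]_(x in D) g x)%E.
Proof.
move=> mf mg fg; rewrite [leLHS]integralE [leRHS]integralE; apply: leeB.
- apply: ge0_le_integral => //.
  + exact: measurable_funepos.
  + exact: measurable_funepos.
  + by move=> x Dx; rewrite !funeposE ge_max !le_max (fg x Dx) lexx orbT.
- apply: ge0_le_integral => //.
  + exact: measurable_funeneg.
  + exact: measurable_funeneg.
  + by move=> x Dx; rewrite !funenegE ge_max !le_max leeN2 (fg x Dx) lexx orbT.
Qed.

End real_integrals.

Section ground_state.
Context {R : realType} {n : nat}.
Variable p : R.
Hypothesis p1 : 1 < p.
Variable Omega : set 'rV[R]_n.
Hypothesis oO : open Omega.
Hypothesis bO : bounded_set Omega.
Hypothesis Omega0 : Omega !=set0.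
Variable i0 : 'I_n.
Local Notation leb := (lebesgue_rV R n).
Local Notation mu := (mu_Omega p Omega).
Local Notation V := (volume Omega).
Variable u : 'rV[R]_n -> R.
Hypothesis hu : weak_solution p Omega (mu / V) u.

Let mO : measurable Omega. Proof. exact: open_rV_measurable. Qed.
Let pgt0 : 0 < p. Proof. exact: lt_trans p1. Qed.

Lemma volume_gt0 : 0 < V.
Proof.
have [x Ox] := Omega0; apply: fine_gt0; apply/andP; split; last exact: bounded_open_lty.
rewrite (open_bigcup_obox oO) in Ox.
have [k kO kx] := Ox.
have ko : obox (rat_lo k) (rat_hi k) `<=` Omega.
  by move=> y ky; apply: kO => i; have /andP[/ltW -> /ltW ->] := ky i.
have ab (i : 'I_n) : @rat_lo R n k i < @rat_hi R n k i.
  by have /andP[h1 h2] := kx i; exact: lt_trans h2.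
apply: lt_le_trans (lebesgue_obox_gt0 ab) _.
by apply: le_measure => //; rewrite inE //; exact: measurable_obox.
Qed.
Let V0 := volume_gt0.

Let lebO : leb Omega = V%:E.
Proof. by rewrite fineK // ge0_fin_numE //; exact: bounded_open_lty. Qed.

Lemma ground_energy : grad_energy p Omega u = mu%:E.
Proof.
rewrite (weak_solution_energy p1 oO hu) lebO -EFinM divfK //.
by rewrite gt_eqF.
Qed.

Lemma mu_ge0 : 0 <= mu.
Proof.
rewrite -lee_fin -ground_energy; apply: integral_ge0 => x _.
by rewrite lee_fin powR_ge0.
Qed.

(** If $\mu$ were 0, then $u$ would have zero gradient, hence zero mean,
    although it is positive. *)
Lemma mu_gt0 : 0 < mu.
Proof.
rewrite lt_def mu_ge0 andbT; apply/eqP => mu0.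
have [W01u _ _] := hu; have [[Lu _] _] := W01u; have [mu_ _] := Lu.
have E0 : grad_energy p Omega u = 0%E by rewrite ground_energy mu0.
have I0 := W01p_grad0_integral0 p1 oO bO i0 W01u E0.
have upos := weak_solution_gt0 oO hu.
have : (\int[leb]_(x in Omega) `|(u x)%:E| = 0)%E.
  rewrite -I0; apply: ae_eq_integral => //.
  - by apply: measurableT_comp => //; exact/measurable_EFinP.
  - exact/measurable_EFinP.
  - by apply: filterS upos => x ux Ox; rewrite gee0_abs // lee_fin ltW ?ux.
move=> /(ae_eq_integral_abs leb mO ((measurable_EFinP _ _).2 mu_)) ueq.
have : {ae leb, forall x, Omega x -> False}.
  apply: filterS2 upos ueq => x ux u0 Ox.
  by have := ux Ox; have [->] := u0 Ox; rewrite ltxx.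
move=> [N [mN N0 ON]]; have : leb Omega = 0%E.
  apply/eqP; rewrite eq_le measure_ge0 andbT -N0; apply: le_measure; rewrite ?inE //.
  by move=> x Ox; apply: ON => /(_ Ox).
by rewrite lebO => -[V00]; have := V0; rewrite V00 ltxx.
Qed.

Let l (x : 'rV[R]_n) : R := ln (u x).

Let mu_fun : measurable_fun Omega u. Proof. by case: hu => -[[[]]]. Qed.

Let ml : measurable_fun Omega l.
Proof. exact: measurableT_comp (@measurable_ln R) mu_fun. Qed.

Let mel (r : R) : measurable_fun Omega (fun x => expR (r * l x)).
Proof. by apply: measurableT_comp => //; exact: measurable_funM. Qed.

Let ul : {ae leb, forall x, Omega x -> u x = expR (l x)}.
Proof. by apply: filterS (weak_solution_gt0 oO hu) => x ux Ox; rewrite lnK // posrE ux. Qed.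

(** [weak_solution_ineq] with $1/u$ written as $e^{-\log u}$; from here on only
    $l = \log u$ is used, which has the advantage that $e^l$ is positive
    everywhere. *)
Lemma ground_ineq v : W01p p Omega v ->
  ((mu / V)%:E * \int[leb]_(x in Omega) (expR (- l x) * `|v x|)%:E <=
   ((p - 1) / p * mu)%:E + p^-1%:E * grad_energy p Omega v)%E.
Proof.
move=> W01v; have [[[mv _] _] _] := W01v.
have := weak_solution_ineq p1 oO bO hu (divr_ge0 mu_ge0 (ltW V0)) W01v.
rewrite -/(volume Omega) divfK ?gt_eqF //; apply: le_trans.
rewrite le_eqVlt; apply/orP; left; apply/eqP; congr (_ * _)%E.
apply: ae_eq_integral => //.
- apply/measurable_EFinP/measurable_funM; last exact: measurableT_comp.
  by have := mel (-1); under eq_fun do rewrite mulN1r.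
- apply/measurable_EFinP/measurable_funM; last exact: measurableT_comp.
  exact: (measurable_recip hu).
- apply: filterS2 ul (weak_solution_gt0 oO hu) => x ux u0 Ox.
  by rewrite recipE ?u0 // [in RHS]ux // expRN.
Qed.

Let iel : leb.-integrable Omega (EFin \o (fun x => expR (l x))).
Proof.
have [[[Lu _] _] _ _] := hu.
have /integrableP[_ ufin] := in_Lp_integrable p1 oO bO Lu.
apply/integrableP; split.
  by apply/measurable_EFinP; exact: measurableT_comp.
apply: le_lt_trans ufin; rewrite le_eqVlt; apply/orP; left; apply/eqP.
apply: ae_eq_integral => //.
- by apply: measurableT_comp => //; apply/measurable_EFinP; exact: measurableT_comp.
- by apply: measurableT_comp => //; exact/measurable_EFinP.
- by apply: filterS ul => x ux Ox /=; rewrite [in RHS]ux.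
Qed.

Let icst (c : R) : leb.-integrable Omega (EFin \o (fun=> c)).
Proof. by apply: integrable_cst_EFin => //; exact: bounded_open_lty. Qed.

Let Icst (c : R) : \int[leb]_(x in Omega) c = c * V.
Proof. exact: Rintegral_cst. Qed.

Let mexpq r : measurable_fun Omega (fun x => expq (l x) r).
Proof.
by apply: measurable_funM => //; apply: measurable_funB => //; exact: mel.
Qed.

Let iexpq r : 0 < r <= 1 -> leb.-integrable Omega (EFin \o (fun x => expq (l x) r)).
Proof.
move=> /andP[r0 r1].
apply: (@le_integrable_EFin _ _ _ leb _ mO _ (fun x => expR (l x) + r^-1)) => //.
  move=> x _; have := expq_mono (l x) r0 r1.
  have e0 := expR_gt0 (r * l x); have e1 := expR_gt0 (l x).
  have ri : 0 < r^-1 by rewrite invr_gt0.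
  rewrite {2}/expq mul1r divr1 => h; rewrite ler_norml; apply/andP; split; last by lra.
  rewrite /expq mulrBl mul1r.
  have : 0 <= expR (r * l x) / r by rewrite mulr_ge0 ?expR_ge0 // ltW.
  lra.
exact: integrableD_EFin.
Qed.

(** The mean of $(u^r-1)/r$, which replaces the $r$-mean of $u$: it bounds the
    logarithm of the latter from above and is monotone in $r$. *)
Let mean r : R := \int[leb]_(x in Omega) expq (l x) r / V.

Let mean_mono r s : 0 < r -> r <= s -> s <= 1 -> mean r <= mean s.
Proof.
move=> r0 rs s1; rewrite ler_pM2r ?invr_gt0 //; apply: le_Rintegral => //.
- by apply: iexpq; rewrite r0 (le_trans rs).
- by apply: iexpq; rewrite (lt_le_trans r0 rs).
- by move=> x _; exact: expq_mono.
Qed.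

Let ierl r : 0 < r <= 1 -> leb.-integrable Omega (EFin \o (fun x => expR (r * l x))).
Proof.
move=> /andP[r0 r1].
rewrite (_ : (fun x => expR (r * l x)) = fun x => r * expq (l x) r + 1); last first.
  by apply/funext => x; rewrite /expq [r * (_ / _)]mulrC divfK ?subrK // gt_eqF.
apply: integrableD_EFin => //; apply: integrableZ_EFin => //.
by apply: iexpq; rewrite r0.
Qed.

Let Ierl r : 0 < r <= 1 -> \int[leb]_(x in Omega) expR (r * l x) = (1 + r * mean r) * V.
Proof.
move=> r01; have /andP[r0 r1] := r01.
transitivity (\int[leb]_(x in Omega) (r * expq (l x) r + 1)).
  by apply: eq_Rintegral => x _; rewrite /expq [r * (_ / _)]mulrC divfK ?subrK // gt_eqF.
rewrite RintegralD //; last by apply: integrableZ_EFin => //; exact: iexpq.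
rewrite Icst RintegralZl //; last exact: iexpq.
by rewrite /mean; field; rewrite gt_eqF.
Qed.

Let RintE f : leb.-integrable Omega (EFin \o f) ->
  (\int[leb]_(x in Omega) (f x)%:E)%E = (\int[leb]_(x in Omega) f x)%:E.
Proof. by move=> fi; rewrite /Rintegral fineK //; exact: integrable_fin_num. Qed.

Let energy_ge0 v : (0 <= grad_energy p Omega v)%E.
Proof. by apply: integral_ge0 => x _; rewrite lee_fin powR_ge0. Qed.

(** The basic inequality for the multiple $v/s$ of $v$, the best one. *)
Lemma ground_ineq_homogeneous v (s e : R) : W01p p Omega v ->
  grad_energy p Omega v = e%:E -> 0 < s ->
  (\int[leb]_(x in Omega) (expR (- l x) * `|v x|)%:E = (s * V)%:E)%E ->
  mu * s `^ p <= e.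
Proof.
move=> W01v Ee s0 Is; have [W1v _] := W01v; have [[mv _] _] := W1v.
have t0 : 0 < s^-1 by rewrite invr_gt0.
have := ground_ineq (W01pZ p1 oO bO s^-1 W01v).
rewrite (grad_energyZ p1 oO bO) // Ee.
rewrite (_ : (\int[leb]_(x in Omega) _)%E = V%:E); last first.
  under eq_integral do rewrite normrM mulrCA EFinM.
  rewrite ge0_integralZl_EFin //.
  - by rewrite Is -EFinM (gtr0_norm t0) mulrA mulVf ?mul1r // gt_eqF.
  - apply/measurable_EFinP/measurable_funM; last exact: measurableT_comp.
    by have := mel (-1); under eq_fun do rewrite mulN1r.
rewrite -!EFinM -EFinD lee_fin divfK ?gt_eqF // (gtr0_norm t0).
have -> : s^-1 `^ p = (s `^ p)^-1.
  by rewrite -powR_inv1 ?(ltW s0) // -powRrM mulN1r powRN.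
have sp : 0 < s `^ p by rewrite powR_gt0.
move=> h; have {}h : mu / p <= p^-1 * ((s `^ p)^-1 * e).
  rewrite -lerBlDl in h; apply: le_trans h; rewrite le_eqVlt; apply/orP; left; apply/eqP.
  by field; rewrite gt_eqF.
rewrite -ler_pdivlMr // mulrC -(ler_pM2l (_ : 0 < p^-1)) ?invr_gt0 //.
by rewrite [p^-1 * mu]mulrC; exact: h.
Qed.

Let F (q : R) := (lambda_q p Omega q * (V `^ (p / q))%:E)%E.

Let powV (a : R) : V `^ a = expR (a * ln V).
Proof. by rewrite /powR gt_eqF. Qed.

(** Lower bound on the infimum defining $\lambda_q$: the basic inequality bounds
    the energy of $v$ from below by the mean of $|v|/u$, and the latter is
    bounded from below by interpolating $|v|^q$ between $|v|/u$ and $u^r$,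
    where $r = q/(1-q)$ is the exponent for which $u$ cancels out. *)
Lemma lambda_q_ge q : 0 < q < 1 -> q / (1 - q) <= 1 ->
  ((mu * expR (- p * mean (q / (1 - q))))%:E <= F q)%E.
Proof.
move=> q01 r1; have /andP[q0 q1] := q01.
have q'0 : 0 < 1 - q by rewrite subr_gt0.
pose r := q / (1 - q); have r0 : 0 < r by rewrite divr_gt0.
have r01 : 0 < r <= 1 by rewrite r0.
pose A := mean r.
suff lb : ((mu * expR (- p * A - p / q * ln V))%:E <= lambda_q p Omega q)%E.
  apply: le_trans (lee_wpmul2r _ lb); last by rewrite lee_fin powR_ge0.
  by rewrite -EFinM lee_fin -[leRHS]mulrA powV -expRD subrK.
apply: le_ereal_inf_tmp => _ [v [W01v vq] <-].
have [W1v _] := W01v; have [[mv _] _] := W1v.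
case E : (grad_energy p Omega v) (energy_ge0 v) => [e| |] //; last first.
  by move=> _; rewrite leey.
rewrite lee_fin => e0.
have mel1 : measurable_fun Omega (fun x => expR (- l x) * `|v x|).
  apply: measurable_funM; last exact: measurableT_comp.
  by have := mel (-1); under eq_fun do rewrite mulN1r.
have S0 : (0 <= \int[leb]_(x in Omega) (expR (- l x) * `|v x|)%:E)%E.
  by apply: integral_ge0 => x _; rewrite lee_fin mulr_ge0 ?expR_ge0.
have iv : leb.-integrable Omega (EFin \o (fun x => expR (- l x) * `|v x|)).
  apply/integrableP; split; first exact/measurable_EFinP.
  rewrite (eq_integral (fun x => (expR (- l x) * `|v x|)%:E)); last first.
    by move=> x _; rewrite /= ger0_norm // mulr_ge0 ?expR_ge0.
  have := ground_ineq W01v; rewrite E -EFinM -EFinD.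
  move: S0; case: (\int[leb]_(x in Omega) _)%E => [y _ _|_|] //; first exact: ltry.
  by rewrite gt0_muley // lte_fin divr_gt0 ?mu_gt0.
pose S := \int[leb]_(x in Omega) (expR (- l x) * `|v x|).
pose s := S / V.
have Is : (\int[leb]_(x in Omega) (expR (- l x) * `|v x|)%:E = (s * V)%:E)%E.
  by rewrite RintE // /s divfK // gt_eqF.
(* the mean of $|v|/u$ is bounded below by testing the interpolation with
   every upper bound $e^z$ of it, which also covers the case of a zero mean *)
have claim z : s <= expR z -> - A - ln V / q <= z.
  move=> sz.
  have pw x : `|v x| `^ q <= expR (q * (z + A)) *
      (q * (expR (- z) * (expR (- l x) * `|v x|)) +
       (1 - q) * (expR (- (r * A)) * expR (r * l x))).
    have X0 : 0 <= expR (- z) * (expR (- l x) * `|v x|).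
      by rewrite !mulr_ge0 ?expR_ge0.
    have Y0 : 0 <= expR (- (r * A)) * expR (r * l x) by rewrite mulr_ge0 ?expR_ge0.
    rewrite -ler_pdivrMl ?expR_gt0 //; apply: le_trans (weighted_amgm q01 X0 Y0).
    rewrite !powRM ?mulr_ge0 ?expR_ge0 // ![expR _ `^ _]/powR !gt_eqF ?expR_gt0 // !expRK.
    rewrite le_eqVlt; apply/orP; left; apply/eqP.
    rewrite [RHS](_ : _ = (expR (q * - z) * expR (q * - l x) *
      (expR ((1 - q) * - (r * A)) * expR ((1 - q) * (r * l x)))) * `|v x| `^ q);
      last by ring.
    rewrite -!expRD -expRN; congr (expR _ * _).
    by rewrite /r; field; rewrite gt_eqF.
  have := @measurable_le_integral _ _ _ leb _ mO (fun x => (`|v x| `^ q)%:E)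
    (fun x => (expR (q * (z + A)) *
      (q * (expR (- z) * (expR (- l x) * `|v x|)) +
       (1 - q) * (expR (- (r * A)) * expR (r * l x))))%:E).
  have i1 := integrableZ_EFin mO q (integrableZ_EFin mO (expR (- z)) iv).
  have i2 := integrableZ_EFin mO (1 - q) (integrableZ_EFin mO (expR (- (r * A))) (ierl r01)).
  have i3 := integrableZ_EFin mO (expR (q * (z + A))) (integrableD_EFin mO i1 i2).
  rewrite [X in _ -> _ -> _ -> (_ <= X)%E](RintE i3) vq => H.
  have {H} : (1 <= (\int[leb]_(x in Omega) (expR (q * (z + A)) *
      (q * (expR (- z) * (expR (- l x) * `|v x|)) +
       (1 - q) * (expR (- (r * A)) * expR (r * l x)))))%:E)%E.
    apply: H.
    - by apply/measurable_EFinP/measurable_fun_powR; exact: measurableT_comp.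
    - exact: measurable_int i3.
    - by move=> x _; rewrite lee_fin.
  rewrite RintegralZl //; last exact: integrableD_EFin.
  rewrite RintegralD // RintegralZl //; last exact: integrableZ_EFin.
  rewrite RintegralZl // RintegralZl //; last by apply: integrableZ_EFin => //; exact: ierl.
  rewrite RintegralZl //; last exact: ierl.
  rewrite Ierl // -/S lee_fin => h.
  have b1 : expR (- z) * S <= V.
    by rewrite expRN mulrC ler_pdivrMr ?expR_gt0 // mulrC -ler_pdivrMr.
  have b2 : expR (- (r * A)) * ((1 + r * mean r) * V) <= V.
    rewrite mulrA ler_piMl ?(ltW V0) // expRN mulrC ler_pdivrMr ?expR_gt0 // mul1r.
    exact: expR_ge1Dx.
  have {}h : 1 <= expR (q * (z + A)) * V.
    apply: le_trans h _; rewrite ler_pM2l ?expR_gt0 //.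
    have := ler_wpM2l (ltW q0) b1; have := ler_wpM2l (ltW q'0) b2; lra.
  have : 0 <= q * (z + A) + ln V.
    by rewrite -(@expRK R (q * (z + A))) -lnM ?posrE ?expR_gt0 // ln_ge0.
  move=> h0; rewrite -(ler_pM2l q0) mulrBr mulrN [q * (ln V / q)]mulrC divfK ?gt_eqF //.
  by move: h0; rewrite mulrDr; lra.
have s0 : 0 < s.
  rewrite ltNge; apply/negP => s0.
  by have := claim (- A - ln V / q - 1) (le_trans s0 (expR_ge0 _)); lra.
apply: le_trans (_ : (mu * s `^ p)%:E <= _)%E; last first.
  by rewrite lee_fin; exact: ground_ineq_homogeneous E s0 Is.
rewrite lee_fin ler_wpM2l ?mu_ge0 // /powR gt_eqF // ler_expR.
have := claim (ln s); rewrite lnK // => /(_ (lexx _)) h.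
have := ler_wpM2l (ltW pgt0) h; rewrite mulrBr => {}h.
rewrite (_ : p / q * ln V = p * (ln V / q)); last by rewrite mulrAC mulrA.
by rewrite mulNr -mulrN.
Qed.

(** Upper bound, from the multiple of $u$ that is admissible for $\lambda_q$
    and Jensen's inequality. *)
Lemma lambda_q_le q : 0 < q < 1 -> leb.-integrable Omega (EFin \o l) ->
  (F q <= (mu * expR (- p * (\int[leb]_(x in Omega) l x / V)))%:E)%E.
Proof.
move=> /andP[q0 q1] il; have q01 : 0 < q <= 1 by rewrite q0 ltW.
have [W01u _ _] := hu; have [W1u _] := W01u.
pose L := \int[leb]_(x in Omega) l x / V.
pose Q := \int[leb]_(x in Omega) expR (q * l x).
(* Jensen: the exponential lies above its tangent at $qL$ *)
have QV : expR (q * L) * V <= Q.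
  have ia := integrableD_EFin mO (icst (1 - q * L)) (integrableZ_EFin mO q il).
  have -> : expR (q * L) * V =
     \int[leb]_(x in Omega) (expR (q * L) * (1 - q * L + q * l x)).
    rewrite RintegralZl // RintegralD //; last exact: integrableZ_EFin.
    have IL : \int[leb]_(x in Omega) l x = L * V by rewrite /L divfK ?gt_eqF.
    by rewrite Icst RintegralZl // IL; ring.
  apply: le_Rintegral => //; [exact: integrableZ_EFin|exact: ierl|].
  move=> x _; rewrite (_ : q * l x = q * L + (q * l x - q * L)); last by ring.
  rewrite [leRHS]expRD ler_pM2l ?expR_gt0 //.
  by have := expR_ge1Dx (q * l x - q * L); lra.
have Q0 : 0 < Q by apply: lt_le_trans QV; rewrite mulr_gt0 ?expR_gt0.
pose z := - ln Q / q.
have inf : (lambda_q p Omega q <= (expR (p * z) * mu)%:E)%E.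
  apply: ge_ereal_inf; exists (grad_energy p Omega (fun x => expR z * u x)); last first.
    rewrite (grad_energyZ p1 oO bO) // ground_energy -EFinM lee_fin.
    by rewrite gtr0_norm ?expR_gt0 // /powR gt_eqF ?expR_gt0 // expRK.
  exists (fun x => expR z * u x); last exact: erefl.
  split; first exact: (W01pZ p1 oO bO).
  transitivity (\int[leb]_(x in Omega) (expR (q * z) * expR (q * l x))%:E)%E.
    apply: ae_eq_integral => //.
    - by apply/measurable_EFinP/measurable_fun_powR/measurableT_comp => //; exact: measurable_funM.
    - by apply/measurable_EFinP; exact: measurable_funM.
    - apply: filterS ul => x ux Ox; rewrite ux // -expRD gtr0_norm ?expR_gt0 //.
      by rewrite /powR gt_eqF ?expR_gt0 // expRK mulrDr expRD.
  rewrite (RintE (integrableZ_EFin mO _ (ierl q01))) RintegralZl //; last exact: ierl.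
  have QE : Q = expR (ln Q) by rewrite lnK ?posrE.
  rewrite -/Q [X in (_ * X)%:E]QE -expRD /z [q * _]mulrC divfK ?gt_eqF //.
  by rewrite addNr expR0.
apply: le_trans (lee_wpmul2r _ inf) _; first by rewrite lee_fin powR_ge0.
rewrite -EFinM lee_fin mulrAC [leRHS]mulrC ler_wpM2r ?mu_ge0 // powV -expRD ler_expR.
have : q * L + ln V <= ln Q.
  by rewrite -(@expRK R (q * L)) -lnM ?posrE ?expR_gt0 // ler_ln ?posrE ?mulr_gt0 ?expR_gt0.
rewrite -/L -(ler_pM2l (_ : 0 < p / q)) ?divr_gt0 // => h.
have e1 : p / q * (q * L + ln V) = p * L + p / q * ln V by field; rewrite gt_eqF.
have e2 : p * z = - (p / q * ln Q) by rewrite /z; field; rewrite gt_eqF.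
by rewrite e2; move: h; rewrite e1; lra.
Qed.

(** If $q < 1/(k+2)$ then $q/(1-q) \le 1/(k+1)$. *)
Let rn (k : nat) : R := k.+1%:R^-1.

Let rn01 k : 0 < rn k <= 1.
Proof. by rewrite invr_gt0 ltr0n /= invf_le1 ?ltr0n // ler1n. Qed.

Lemma near_lambda_q_ge k : \forall q \near 0^'+,
  ((mu * expR (- p * mean (rn k)))%:E <= F q)%E.
Proof.
near=> q.
have q0 : 0 < q by near: q; exact: nbhs_right_gt.
have qk : q < k.+2%:R^-1 by near: q; apply: nbhs_right_lt; rewrite invr_gt0.
have k2 : (0 : R) < k.+2%:R by [].
have k1 : (0 : R) < k.+1%:R by [].
have qk' : q * k.+1%:R <= 1 - q.
  have : q * k.+2%:R < 1 by rewrite -ltr_pdivlMr // mul1r.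
  by rewrite -[k.+2%:R]natr1; move=> h; lra.
have q1 : q < 1 by apply: lt_le_trans qk _; rewrite invf_le1 // ler1n.
have q'0 : 0 < 1 - q by rewrite subr_gt0.
have rk : q / (1 - q) <= rn k.
  by rewrite ler_pdivrMr // /rn mulrC ler_pdivlMr.
have /andP[rk0 rk1] := rn01 k.
apply: le_trans (lambda_q_ge _ (le_trans rk rk1)); last by rewrite q0 q1.
rewrite lee_fin ler_wpM2l ?mu_ge0 // ler_expR !mulNr lerN2 ler_pM2l //.
by apply: mean_mono => //; rewrite divr_gt0.
Unshelve. all: by end_near. Qed.

(** Monotone convergence for the difference quotients of $r \mapsto u^r$. *)
Lemma mean_rn_cvg :
  (((mean 1 - mean (rn k)) * V)%:E @[k --> \oo] -->
   \int[leb]_(x in Omega) (expR (l x) - 1 - l x)%:E)%E.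
Proof.
have e1 x : expR (l x) - 1 = expq (l x) 1 by rewrite /expq mul1r divr1.
have i1 : leb.-integrable Omega (EFin \o (fun x => expq (l x) 1)).
  by apply: iexpq; rewrite ltr01 lexx.
have := @cvg_monotone_convergence _ _ _ leb _ mO
  (fun k x => (expq (l x) 1 - expq (l x) (rn k))%:E).
rewrite (_ : (\int[leb]_(x in Omega) (fun x => _) x)%E =
   (\int[leb]_(x in Omega) (expR (l x) - 1 - l x)%:E)%E); last first.
  apply: eq_integral => x _; apply/cvg_lim => //; apply: cvg_EFin; first exact: nearW.
  by rewrite e1; apply: cvgB; [exact: cvg_cst|exact: expq_cvg].
rewrite (_ : (fun k => \int[leb]_(x in Omega) _)%E =
   (fun k => ((mean 1 - mean (rn k)) * V)%:E)); last first.
  apply/funext => k; have ik := iexpq (rn01 k).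
  have iB : leb.-integrable Omega (EFin \o (fun x => expq (l x) 1 - expq (l x) (rn k))).
    by have := integrableB mO i1 ik; apply: eq_integrable.
  by rewrite (RintE iB) RintegralB // /mean -mulrBl divfK ?gt_eqF.
apply.
- move=> k; apply/measurable_EFinP; exact: measurable_funB.
- move=> k x _; rewrite lee_fin subr_ge0; have /andP[r0 r1] := rn01 k.
  exact: expq_mono.
- move=> x _ k1 k2 k12; rewrite lee_fin lerD2l lerN2.
  have /andP[r0 _] := rn01 k2; apply: expq_mono => //.
  by rewrite lef_pV2 ?posrE ?ltr0n // ler_nat.
Qed.

Let muE : mu = fine (lim (F q @[q --> 0^'+])). Proof. by []. Qed.

Let lim_F (y : \bar R) : F q @[q --> 0^'+] --> y -> mu = fine y.
Proof. by move=> Fy; rewrite muE (cvg_lim (@ereal_hausdorff R) Fy). Qed.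

(** The quantities $\lambda_q |\Omega|^{p/q}$ tend to $\mu e^{-pL}$, where $L$ is
    the mean of $\log u$, and to $+\infty$ if $\log u$ is not integrable. By
    definition the limit is $\mu$, which is positive and finite. *)
Lemma ground_log_integral : leb.-integrable Omega (EFin \o l) /\
  \int[leb]_(x in Omega) l x = 0.
Proof.
pose H := (\int[leb]_(x in Omega) (expR (l x) - 1 - l x)%:E)%E.
have pos x : 0 <= expR (l x) - 1 - l x by have := expR_ge1Dx (l x); lra.
have mH : measurable_fun Omega (fun x => expR (l x) - 1 - l x).
  by apply: measurable_funB => //; apply: measurable_funB => //; exact: measurableT_comp.
have H0 : (0 <= H)%E by apply: integral_ge0 => x _; rewrite lee_fin.
have mup := mu_gt0; have Hcvg := mean_rn_cvg; rewrite -/H in Hcvg.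
have [Hoo|Hfin] := eqVneq H +oo%E.
  exfalso; suff : mu = fine (+oo%E : \bar R) by move=> h; move: mup; rewrite h ltxx.
  apply: lim_F; apply/cvgeyPge => A.
  rewrite Hoo in Hcvg.
  have /cvgeyPge/(_ ((mean 1 + A / (mu * p)) * V)) [k _ /(_ k (leqnn k))] := Hcvg.
  rewrite /= lee_fin ler_pM2r // => hk.
  apply: filterS (near_lambda_q_ge k) => q; apply: le_trans.
  rewrite lee_fin; have mp : 0 < mu * p by rewrite mulr_gt0.
  apply: (@le_trans _ _ (mu * (- p * mean (rn k)))); last first.
    by rewrite ler_pM2l //; have := expR_ge1Dx (- p * mean (rn k)); lra.
  have : A / (mu * p) <= - mean (rn k) by move: hk; lra.
  by rewrite ler_pdivrMr // => h; apply: le_trans h _; rewrite le_eqVlt; apply/orP; left; apply/eqP; ring.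
have Hf : H \is a fin_num by rewrite ge0_fin_numE // ltey.
have iH : leb.-integrable Omega (EFin \o (fun x => expR (l x) - 1 - l x)).
  apply/integrableP; split; first exact/measurable_EFinP.
  rewrite (eq_integral (fun x => (expR (l x) - 1 - l x)%:E)) -/H ?ltey //.
  by move=> x _; rewrite /= ger0_norm.
have ie1 : leb.-integrable Omega (EFin \o (fun x => expR (l x) - 1)).
  by have := integrableD_EFin mO iel (icst (- 1)).
have il : leb.-integrable Omega (EFin \o l).
  have := integrableB mO ie1 iH; apply: eq_integrable => // x _ /=.
  by rewrite -EFinB; congr EFin; ring.
split => //; pose I := \int[leb]_(x in Omega) l x.
have HE : H = (mean 1 * V - I)%:E.
  rewrite /H (RintE iH) RintegralB // /mean divfK ?gt_eqF //; congr (_ - _)%:E.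
  by apply: eq_Rintegral => x _; rewrite /expq mul1r divr1.
rewrite HE in Hcvg; move/fine_cvgP : Hcvg => [_ Hcvg].
have cm : mean (rn k) @[k --> \oo] --> I / V.
  have -> : (fun k => mean (rn k)) =
     (fun k => mean 1 - (fine \o (fun k => ((mean 1 - mean (rn k)) * V)%:E)) k / V).
    by apply/funext => k /=; rewrite mulfK ?gt_eqF // subKr.
  rewrite (_ : I / V = mean 1 - (mean 1 * V - I) / V); last by field; rewrite gt_eqF.
  by apply: cvgB; [exact: cvg_cst|apply: cvgM => //; exact: cvg_cst].
pose Y := mu * expR (- p * (I / V)).
have cy : (mu * expR (- p * mean (rn k))) @[k --> \oo] --> Y.
  apply: cvgM; first exact: cvg_cst.
  apply: (continuous_cvg _ (f := fun k => - p * mean (rn k)) (h := expR)).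
    exact: continuous_expR.
  by apply: cvgM => //; exact: cvg_cst.
have q01 : \forall q \near (0 : R)^'+, 0 < q < 1.
  by near=> q; apply/andP; split; near: q; [exact: nbhs_right_gt|exact: nbhs_right_lt].
have FY : F q @[q --> 0^'+] --> Y%:E.
  apply/fine_cvgP; split.
    apply: filterS2 q01 (near_lambda_q_ge 0) => q q01 lb.
    have ub := lambda_q_le q01 il; rewrite fin_numE; apply/andP; split.
      by rewrite -ltNye; exact: lt_le_trans (ltNyr _) lb.
    by rewrite -ltey; exact: le_lt_trans ub (ltry _).
  apply/cvgrPdist_le => e e0.
  have /cvgrPdist_le/(_ e e0) [k _ /(_ k (leqnn k)) /= hk] := cy.
  apply: filterS2 q01 (near_lambda_q_ge k) => q q01 lb.
  have ub := lambda_q_le q01 il; rewrite -/I -/Y in ub; rewrite /=.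
  move: lb ub; case: (F q) => [f| |] //; rewrite !lee_fin /= => lb ub.
  rewrite ger0_norm ?subr_ge0 //; apply: le_trans (le_trans (ler_norm _) hk).
  by rewrite lerD2l lerN2.
have := lim_F FY; rewrite /= /Y => h.
have : expR (- p * (I / V)) = 1.
  by apply: (mulfI (lt0r_neq0 mup)); rewrite mulr1 -h.
rewrite -expR0 => /expR_inj /eqP; rewrite mulf_eq0 oppr_eq0 gt_eqF //=.
by rewrite mulf_eq0 invr_eq0 [V == 0]gt_eqF // orbF => /eqP.
Unshelve. all: by end_near. Qed.

Lemma log_integral_ground : log_integral Omega u = 0%E.
Proof.
have [il I0] := ground_log_integral.
rewrite /log_integral -[RHS]/(0%:E) -I0 -(RintE il).
apply: ae_eq_integral => //.
- apply: (measurableT_comp (@measurable_lne_EFin R)).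
  exact: measurableT_comp.
- exact/measurable_EFinP.
- apply: filterS (weak_solution_gt0 oO hu) => x ux Ox.
  by rewrite gtr0_norm ?ux // lne_EFin // ux.
Qed.

Lemma J_ground : J p Omega u = (mu / p)%:E.
Proof.
rewrite /J log_integral_ground ground_energy.
transitivity (p^-1 * mu - mu / V * 0)%:E; first by [].
by rewrite mulr0 subr0 mulrC.
Qed.

(** Since $\log u$ has zero mean, $\log|v| - \log u \le |v|/u - 1$ bounds the
    logarithmic term by the left side of the basic inequality. *)
Lemma J_ge v : W01p p Omega v -> ((mu / p)%:E <= J p Omega v)%E.
Proof.
move=> W01v; have [[[mv _] _] _] := W01v; have [il I0] := ground_log_integral.
rewrite /J; case: ifP => [Lfin|_]; last by rewrite leey.
have mup := mu_gt0; have lamp : 0 < mu / V by rewrite divr_gt0.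
have gi := ground_ineq W01v.
move: Lfin; case L : (log_integral Omega v) => [a| |] // _.
case E : (grad_energy p Omega v) (energy_ge0 v) gi => [e| |] //; last first.
  move=> _ _; rewrite gt0_muley ?lte_fin ?invr_gt0 // -EFinM leey //.
move=> _ gi.
have mel1 : measurable_fun Omega (fun x => expR (- l x) * `|v x|).
  apply: measurable_funM; last exact: measurableT_comp.
  by have := mel (-1); under eq_fun do rewrite mulN1r.
have S0 : (0 <= \int[leb]_(x in Omega) (expR (- l x) * `|v x|)%:E)%E.
  by apply: integral_ge0 => x _; rewrite lee_fin mulr_ge0 ?expR_ge0.
have iv : leb.-integrable Omega (EFin \o (fun x => expR (- l x) * `|v x|)).
  apply/integrableP; split; first exact/measurable_EFinP.
  rewrite (eq_integral (fun x => (expR (- l x) * `|v x|)%:E)); last first.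
    by move=> x _; rewrite /= ger0_norm // mulr_ge0 ?expR_ge0.
  move: gi; rewrite -EFinM -EFinD.
  move: S0; case: (\int[leb]_(x in Omega) _)%E => [y _ _|_|] //; first exact: ltry.
  by rewrite gt0_muley // lte_fin.
rewrite (RintE iv) -EFinM -EFinM -EFinD lee_fin in gi.
pose S := \int[leb]_(x in Omega) (expR (- l x) * `|v x|).
have ig := integrableD_EFin mO (integrableD_EFin mO il iv) (icst (- 1)).
have : (log_integral Omega v <=
    \int[leb]_(x in Omega) (l x + expR (- l x) * `|v x| + - 1)%:E)%E.
  apply: measurable_le_integral => //.
  - apply: (measurableT_comp (@measurable_lne_EFin R)).
    exact: measurableT_comp.
  - exact: measurable_int ig.
  - move=> x _; have [v0|v0] := leP `|v x| 0; first by rewrite /lne v0 leNye.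
    rewrite lne_EFin // lee_fin.
    have := expR_ge1Dx (ln `|v x| - l x).
    rewrite expRD lnK ?posrE // mulrC; lra.
rewrite L (RintE ig) lee_fin RintegralD //; last exact: integrableD_EFin.
rewrite RintegralD // I0 add0r Icst mulN1r -/S => aS.
rewrite -/S in gi.
rewrite -!EFinM -EFinB lee_fin.
have h1 : mu / V * a <= mu / V * S - mu.
  have := ler_wpM2l (ltW lamp) aS.
  by rewrite mulrBr divfK ?gt_eqF.
have h2 : (p - 1) / p * mu = mu - mu / p by field; rewrite gt_eqF.
by move: gi h1; rewrite h2; lra.
Qed.

End ground_state.

Theorem theorem17 (R : realType) (N : nat) (p : R) (Omega : set 'rV[R]_N)
    (u : 'rV[R]_N -> R) (hN : (2 <= N)%N) (hp : 1 < p)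
    (hOmega : smooth_bounded_domain Omega)
    (hu : weak_solution p Omega (mu_Omega p Omega / volume Omega) u) :
  J p Omega u = (mu_Omega p Omega / p)%:E /\
  is_min [set J p Omega v | v in [set v | W01p p Omega v]]
    (mu_Omega p Omega / p)%:E.
Proof.
case: (hOmega) => Omega0 oO _ bO _.
pose i0 : 'I_N := Ordinal (ltn_trans (ltnSn 0) hN).
have Ju := J_ground hp oO bO Omega0 i0 hu.
split => //; split; first by exists u => //; case: hu.
by move=> _ [v W01v <-]; exact: (J_ge hp oO bO Omega0 i0 hu W01v).
Qed.
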